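(* Let $G$ be any probability measure on $[0,\infty)$. Then there exists a convex, deterministic function $\Lambda:[0,\infty)\to[0,\infty)$, depending on $G$, such that for every $v\ge 0$, \[\Lambda(v)=\lim_{n\to\infty}\frac1n T((0,0),(n,\lceil vn\rceil))\] almost surely and in $L^1$.
   Context: Model: Let $G$ be a probability measure on $[0,\infty)$. In the nearest-neighbour lattice $\mathbb Z^2$, every vertical edge (joining $(x,y)$ and $(x,y+1)$) receives the deterministic weight $\tau_e=1$, and every horizontal edge (joining $(x,y)$ and $(x+1,y)$) receives a random weight $\tau_e$, the horizontal weights being independent with law $G$. A path is a sequence $p=(z_0,z_1,\dots)$ of points of $\mathbb Z^2$ with $z_k,z_{k+1}$ joined by an edge; an edge $e$ lies in $p$ if $e=(z_k,z_{k+1})$ for some $k$. The passage time is $T(p)=\sum_{e\in p}\tau_e$, and for $u,w\in\mathbb Z^2$, $T(u,w)=\inf_p T(p)$ over all paths from $u$ to $w$. $\lceil a\rceil$ is the smallest integer $\ge a$. *)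

(* Defs.v *)
From HB Require Import structures.
From mathcomp Require Import all_boot all_order all_algebra.
From mathcomp Require Import all_classical all_reals all_analysis.
Set Implicit Arguments. Unset Strict Implicit. Unset Printing Implicit Defensive.
Import Order.TTheory GRing.Theory Num.Theory.
Local Open Scope classical_set_scope.
Local Open Scope ring_scope.

Definition pt := (int * int)%type.

Definition adj (a b : pt) : bool :=
  ((a.2 == b.2) && ((b.1 == a.1 + 1) || (a.1 == b.1 + 1))) ||
  ((a.1 == b.1) && ((b.2 == a.2 + 1) || (a.2 == b.2 + 1))).

Section FPP.
Variable R : realType.

(* [hw (x,y)] is the weight of the horizontal edge joining (x,y) and (x+1,y).
   Vertical edges have weight 1. For adjacent a b, [edge_weight hw a b] is
   the weight of the edge {a,b}. *)
Definition edge_weight (hw : pt -> R) (a b : pt) : R :=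
  if a.2 == b.2 then hw (Order.min a.1 b.1, a.2) else 1.

Definition is_path_from_to (u w : pt) (p : seq pt) : Prop :=
  path adj u p /\ last u p = w.

Definition path_time (hw : pt -> R) (u : pt) (p : seq pt) : R :=
  \sum_(t <- pairmap (edge_weight hw) u p) t.

Definition passage_time (hw : pt -> R) (u w : pt) : R :=
  inf [set path_time hw u p | p in [set p | is_path_from_to u w p]].

Definition mutually_independent {d} {Omega : measurableType d}
  (P : probability Omega R) {I : eqType} (X : I -> Omega -> R) : Prop :=
  forall (s : seq I) (A : I -> set R), uniq s ->
    (forall i, measurable (A i)) ->
    P (\bigcap_(i in [set` s]) (X i @^-1` A i)) =
    (\prod_(i <- s) P (X i @^-1` A i))%E.

Definition convex_on_nonneg (L : R -> R) : Prop :=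
  forall a b t : R, 0 <= a -> 0 <= b -> 0 <= t <= 1 ->
    L (t * a + (1 - t) * b) <= t * L a + (1 - t) * L b.

End FPP.

(* Main.v *)
Require Import Defs.
From HB Require Import structures.
From mathcomp Require Import all_boot all_order all_algebra.
From mathcomp Require Import all_classical all_reals all_analysis.
From mathcomp Require Import measurable_realfun zify ring lra.
Import Order.TTheory GRing.Theory Num.Theory.
Import numFieldNormedType.Exports.
Local Open Scope classical_set_scope.
Local Open Scope ring_scope.

(** Since vertical edges cost 1, a column is crossed at cost at most
    [min_j (2 j + tau_j)], which is integrable whatever the law [G] is. Hence the
    expected passage times [e n] restricted to the strip between the two end
    columns are finite and subadditive up to a constant, and [e n / n]
    converges (Fekete) to [Lambda v]; concatenation gives convexity.

    Upper bound: blocks in disjoint strips are i.i.d., and their averages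
    converge. Lower bound: modifying one edge changes every passage time by a
    bounded amount, so by the zero-one law [liminf T n / n < q] has probability
    0 or 1. If it has probability 1, then from most columns there is a jump of
    bounded length and cost at most [q] per column; chaining such jumps greedily,
    and paying one column crossing at the rare bad columns, yields strip paths of
    expected cost at most about [q n], so [Lambda v <= q]. The same greedy argument
    proves the one-sided law of large numbers needed for the upper bound.
    Convergence in L^1 follows because the expectations converge and the negative
    part of [T n / n - Lambda v] is bounded.

    The proof is carried out on the space of environments [pt -> R] with its
    cylinder sigma-algebra; all models induce there the same law. *)

Set Implicit Arguments. Unset Strict Implicit. Unset Printing Implicit Defensive.

(** * Passage times restricted to a set of columns *)

Section RestrictedTime.
Context {R : realType}.
Implicit Types (P : pred int) (hw : pt -> R) (u w z : pt) (p : seq pt).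

Definition col_path P u w p :=
  [/\ path adj u p, last u p = w & all (fun z : pt => P z.1) (u :: p)].

(** Only the columns are restricted: vertical moves inside a column stay free, and the time depends
    on no weights outside [P]. Taking [xpredT] gives the full passage time. *)
Definition restricted_time P hw u w : R :=
  inf [set path_time hw u p | p in col_path P u w].

Definition reach P hw u w (c : R) :=
  exists2 p, col_path P u w p & path_time hw u p <= c.

Definition col_convex P :=
  forall x y z : int, x <= y -> y <= z -> P x -> P z -> P y.

Lemma path_time_nil hw u : path_time hw u [::] = 0.
Proof. by rewrite /path_time /= big_nil. Qed.

Lemma path_time_cons hw u z p :
  path_time hw u (z :: p) = edge_weight hw u z + path_time hw z p.
Proof. by rewrite /path_time /= big_cons. Qed.

Lemma path_time_cat hw u p1 p2 :
  path_time hw u (p1 ++ p2) = path_time hw u p1 + path_time hw (last u p1) p2.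
Proof. by rewrite /path_time pairmap_cat big_cat. Qed.

Lemma edge_weight_ge0 hw u w : (forall e, 0 <= hw e) -> 0 <= edge_weight hw u w.
Proof. by move=> h; rewrite /edge_weight; case: ifP. Qed.

Lemma path_time_ge0 hw u p : (forall e, 0 <= hw e) -> 0 <= path_time hw u p.
Proof.
move=> h; elim: p u => [|z p ih] v; first by rewrite path_time_nil.
by rewrite path_time_cons addr_ge0 ?edge_weight_ge0.
Qed.

Lemma passage_timeE hw u w : passage_time hw u w = restricted_time xpredT hw u w.
Proof.
congr (inf _); apply/seteqP; split => t [p].
  by move=> [h1 h2] <-; exists p => //; split=> //=; apply/allP.
by move=> [h1 h2 _] <-; exists p.
Qed.

Lemma reach_refl P hw u : P u.1 -> reach P hw u u 0.
Proof. by move=> h; exists [::]; rewrite ?path_time_nil//; split=> //=; rewrite h. Qed.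

Lemma reach_trans P hw u z w c c' :
  reach P hw u z c -> reach P hw z w c' -> reach P hw u w (c + c').
Proof.
move=> [p [a b e] d] [p' [a' b' e'] d']; exists (p ++ p').
  split; first by rewrite cat_path a b.
    by rewrite last_cat b.
  by rewrite -cat_cons all_cat e /=; case/andP: e'.
by rewrite path_time_cat b lerD.
Qed.

Lemma reach_step P hw u w :
  adj u w -> P u.1 -> P w.1 -> reach P hw u w (edge_weight hw u w).
Proof.
move=> a h1 h2; exists [:: w]; last by rewrite path_time_cons path_time_nil addr0.
by split=> //=; rewrite ?a ?h1 ?h2.
Qed.

Lemma reach_vert P hw (x y y' : int) :
  P x -> reach P hw (x, y) (x, y') (`|y' - y|%:~R).
Proof.
move=> Px; move hn : (absz (y' - y)) => n.
elim: n y hn => [|n ih] y hn.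
  have -> : y = y' by lia.
  by rewrite subrr; exact: reach_refl.
pose s : int := if y' < y then y - 1 else y + 1.
have e1 : (edge_weight hw (x, y) (x, s) : R) = 1.
  rewrite /edge_weight /= /s; case: ifP => //; case: ifP => ? /eqP; lia.
have -> : (`|y' - y|%:~R : R) = 1 + `|y' - s|%:~R.
  by rewrite -[1 in RHS]/(1%:~R) -intrD; congr (_ *~ _); rewrite /s; case: ifP; lia.
apply: (@reach_trans _ _ _ (x, s)).
  rewrite -e1; apply: reach_step => //.
  by rewrite /adj /= /s; case: ifP; lia.
by apply: ih; rewrite /s; case: ifP; lia.
Qed.

Lemma reach_horiz P hw (x y : int) :
  P x -> P (x + 1) -> reach P hw (x, y) (x + 1, y) (hw (x, y)).
Proof.
move=> h1 h2.
have hxy : hw (x, y) = edge_weight hw (x, y) (x + 1, y).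
  by rewrite /edge_weight /= eqxx minEle ifT//; lia.
by rewrite hxy; apply: reach_step => //; rewrite /adj /=; lia.
Qed.

Lemma reach_horiz_back P hw (x y : int) :
  P x -> P (x + 1) -> reach P hw (x + 1, y) (x, y) (hw (x, y)).
Proof.
move=> h1 h2.
have hxy : hw (x, y) = edge_weight hw (x + 1, y) (x, y).
  by rewrite /edge_weight /= eqxx minEle ifF//; lia.
by rewrite hxy; apply: reach_step => //; rewrite /adj /=; lia.
Qed.

(** Walk horizontally to the column of [w], then vertically. Hence the infimum in [restricted_time]
    is over a nonempty set and is not the default value 0. *)
Lemma reach_ex P hw u w : col_convex P -> P u.1 -> P w.1 -> exists c, reach P hw u w c.
Proof.
move=> cP; case: u w => [x y] [x' y'] /=.
move hn : (absz (x' - x)) => n; elim: n x hn => [|n ih] x hn Px Px'.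
  have -> : x = x' by lia.
  by eexists; exact: reach_vert.
have [xx'|xx'] := ltP x x'.
  have Pm : P (x + 1) by apply: (cP x _ x') => //; lia.
  have [|c hc] := ih (x + 1) _ Pm Px'; first by lia.
  by eexists; apply: reach_trans hc; exact: reach_horiz.
have Pm : P (x - 1) by apply: (cP x' _ x) => //; lia.
have [|c hc] := ih (x - 1) _ Pm Px'; first by lia.
eexists; apply: reach_trans hc; rewrite -{1}(subrK 1 x).
by apply: reach_horiz_back => //; rewrite subrK.
Qed.

Section Nonneg.
Variable hw : pt -> R.
Hypothesis hw0 : forall e, 0 <= hw e.

Let times_lb P u w : lbound [set path_time hw u p | p in col_path P u w] 0.
Proof. by move=> _ [p _ <-]; exact: path_time_ge0. Qed.

Lemma restricted_time_ge0 P u w : 0 <= restricted_time P hw u w.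
Proof.
rewrite /restricted_time; set S := (X in inf X).
have [->|S0] := eqVneq S set0; first by rewrite inf0.
by apply: lb_le_inf; [exact/set0P|exact: times_lb].
Qed.

Lemma restricted_time_le P u w c : reach P hw u w c -> restricted_time P hw u w <= c.
Proof.
move=> [p hp]; apply: le_trans; apply: ge_inf; last by exists p.
by exists 0; exact: times_lb.
Qed.

Lemma restricted_time_lt P u w c : col_convex P -> P u.1 -> P w.1 ->
  restricted_time P hw u w < c ->
  exists2 p, col_path P u w p & path_time hw u p < c.
Proof.
move=> cP Pu Pw h.
have [_ [p0 hp0 _]] := @reach_ex P hw u w cP Pu Pw.
have [|_ [p hp <-] hc] := inf_lt _ h; last by exists p.
by exists (path_time hw u p0), p0.
Qed.

Lemma restricted_time_near P u w eps : col_convex P -> P u.1 -> P w.1 -> 0 < eps ->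
  reach P hw u w (restricted_time P hw u w + eps).
Proof.
move=> cP Pu Pw e0.
have [|p hp /ltW h] := @restricted_time_lt P u w (restricted_time P hw u w + eps) cP Pu Pw.
  by rewrite ltrDl.
by exists p.
Qed.

Lemma restricted_time_triangle P z u w : col_convex P -> P u.1 -> P z.1 -> P w.1 ->
  restricted_time P hw u w <= restricted_time P hw u z + restricted_time P hw z w.
Proof.
move=> cP Pu Pz Pw; apply/ler_addgt0Pr => e e0.
have e2 : 0 < e / 2 by lra.
have := reach_trans (restricted_time_near cP Pu Pz e2)
  (restricted_time_near cP Pz Pw e2).
by move/restricted_time_le => h; apply: le_trans h _; lra.
Qed.

(** Fewer columns leave fewer paths. Convexity of [P] keeps the right-hand side from being an
    infimum over the empty set, which would be 0. *)
Lemma restricted_time_mono P P' u w : (forall x, P x -> P' x) ->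
  col_convex P -> P u.1 -> P w.1 ->
  restricted_time P' hw u w <= restricted_time P hw u w.
Proof.
move=> sub cP Pu Pw; apply/ler_addgt0Pr => e e0.
have [p [h1 h2 h3] h4] := restricted_time_near cP Pu Pw e0.
apply: restricted_time_le; exists p => //; split => //.
by apply: sub_all h3 => z; exact: sub.
Qed.

Lemma restricted_time_vert P (x y y' : int) : P x ->
  restricted_time P hw (x, y) (x, y') <= `|y' - y|%:~R.
Proof. by move=> Px; apply: restricted_time_le; exact: reach_vert. Qed.

End Nonneg.

Lemma path_time_le hw hw' u p :
  (forall e, hw e <= hw' e) -> path_time hw u p <= path_time hw' u p.
Proof.
move=> h; elim: p u => [|z p ih] v; first by rewrite !path_time_nil.
by rewrite !path_time_cons lerD// /edge_weight; case: ifP.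
Qed.

Lemma restricted_time_le_weights P hw hw' u w : (forall e, 0 <= hw e) ->
  (forall e, hw e <= hw' e) -> col_convex P -> P u.1 -> P w.1 ->
  restricted_time P hw u w <= restricted_time P hw' u w.
Proof.
move=> h0 h cP Pu Pw; apply/ler_addgt0Pr => e e0.
have [p hp hc] := @restricted_time_near hw' _ _ _ _ cP Pu Pw e0.
apply: restricted_time_le => //; exists p => //.
by apply: le_trans hc; exact: path_time_le.
Qed.

(** A horizontal edge used by a path inside [P] has both ends in [P], so both environments give each
    admissible path the same cost. *)
Lemma restricted_time_local P hw hw' u w :
  (forall x y, P x -> P (x + 1) -> hw (x, y) = hw' (x, y)) ->
  restricted_time P hw u w = restricted_time P hw' u w.
Proof.
move=> h.
have key p v : path adj v p -> all (fun z : pt => P z.1) (v :: p) ->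
    path_time hw v p = path_time hw' v p.
  elim: p v => [|z p ih] v; first by rewrite !path_time_nil.
  rewrite [path _ _ _]/= [all _ _]/= => /andP[az hp] /andP[Pv Pa].
  rewrite !path_time_cons ih//; congr (_ + _).
  rewrite /edge_weight; case: eqVneq => // e12; apply: h.
    by case: (leP v.1 z.1) => // _; case/andP: Pa.
  case/andP: Pa => Pz _.
  have [vz|vz] : z.1 = v.1 + 1 \/ v.1 = z.1 + 1.
    by move: az; rewrite /adj; move: e12; lia.
  - by rewrite min_l -?vz//; lia.
  - by rewrite min_r -?vz//; lia.
congr (inf _); apply/seteqP; split => _ [p [h1 h2 h3] <-]; exists p => //.
  by rewrite key.
by rewrite key.
Qed.

Lemma path_time_shift hw u p z :
  path_time (fun e => hw (e + z)) u p = path_time hw (u + z) [seq v + z | v <- p].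
Proof.
elim: p u => [|v p ih] t; first by rewrite !path_time_nil.
rewrite /= !path_time_cons ih; congr (_ + _).
rewrite /edge_weight /= (inj_eq (addIr _)); case: ifP => // _; congr hw.
by rewrite -addr_minl.
Qed.

Lemma adj_shift u v z : adj (u + z) (v + z) = adj u v.
Proof. by rewrite /adj /=; lia. Qed.

Lemma restricted_time_shift P hw u w z :
  restricted_time P (fun e => hw (e + z)) u w =
  restricted_time (fun x => P (x - z.1)) hw (u + z) (w + z).
Proof.
have path_shift v p t : path adj (v + t) [seq s + t | s <- p] = path adj v p.
  by elim: p v => //= s p ih v; rewrite adj_shift ih.
congr (inf _); apply/seteqP; split => _ [p [h1 h2 h3] <-].
  exists [seq v + z | v <- p]; last by rewrite path_time_shift.
  split; [by rewrite path_shift|by rewrite (last_map (+%R^~ z)) h2|].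
  rewrite -[_ :: _]/([seq v + z | v <- u :: p]) all_map; apply: sub_all h3 => v /=.
  by rewrite addrK.
exists [seq v - z | v <- p]; last first.
  rewrite path_time_shift -map_comp; congr path_time; rewrite -[RHS]map_id.
  by apply: eq_map => v /=; rewrite subrK.
split.
- by rewrite -(addrK z u) path_shift.
- by rewrite -(addrK z u) (last_map (fun v => v - z)) h2 addrK.
- rewrite -(addrK z u) -[_ :: _]/([seq v - z | v <- (u + z) :: p]) all_map.
  by apply: sub_all h3.
Qed.

Definition zero_edge (e : pt) hw : pt -> R := fun e' => if e' == e then 0 else hw e'.

(* With d the distance from u, composing d with a 1-Lipschitz map that
   collapses [d a, d b] gives a potential that is constant across e = {a, b}. *)
Lemma restricted_time_zero_edge hw e u w : (forall e', 0 <= hw e') ->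
  restricted_time xpredT hw u w <= restricted_time xpredT (zero_edge e hw) u w + hw e.
Proof.
move=> hw0.
have hz0 e' : 0 <= zero_edge e hw e' by rewrite /zero_edge; case: ifP.
have cT : col_convex xpredT by [].
pose d z := restricted_time xpredT hw u z.
have dlip a b c : reach xpredT hw a b c -> d b <= d a + c.
  move=> h; rewrite /d; have := @restricted_time_triangle hw hw0 xpredT a u b cT isT isT isT.
  by have := restricted_time_le hw0 h; lra.
pose a := d e; pose b := d (e.1 + 1, e.2).
have ab : b <= a + hw e.
  by apply: dlip; case: (e) => x y; exact: reach_horiz.
have ba : a <= b + hw e.
  by apply: dlip; case: (e) => x y; exact: reach_horiz_back.
pose m := Num.min a b; pose M := Num.max a b.
have mM : [/\ m <= a, m <= b, a <= M, b <= M & M <= m + hw e].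
  rewrite /m /M; split; case: (leP a b); lra.
(* This map is the identity below [m], sends [[m, M]] to [m], and lowers everything above [M] by
   [M - m], which is at most [hw e]. *)
pose g x := Num.min x m + Num.max (x - M) 0.
have glip x y c : 0 <= c -> y <= x + c -> g y <= g x + c.
  move=> c0 xy; rewrite /g; case: mM => *.
  case: (leP y m); case: (leP x m); case: (leP (y - M) 0); case: (leP (x - M) 0); lra.
have gcol x : m <= x -> x <= M -> g x = m.
  move=> h1 h2; rewrite /g; case: (leP x m); case: (leP (x - M) 0); lra.
have gge x : x - hw e <= g x.
  rewrite /g; case: mM => *.
  case: (leP x m); case: (leP (x - M) 0); have := hw0 e; lra.
(* Each edge raises [g (d _)] by at most its new weight: away from [e] because [d] does so and [g]
   is 1-Lipschitz, at [e] because both ends are sent to [m]. *)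
have pot p v : path adj v p -> g (d (last v p)) <= g (d v) + path_time (zero_edge e hw) v p.
  elim: p v => [|z p ih] v /=; first by rewrite path_time_nil addr0.
  case/andP=> az hp; apply: le_trans (ih _ hp) _.
  rewrite path_time_cons addrA lerD2r.
  have dz := dlip _ _ _ (@reach_step xpredT hw v z az isT isT).
  move: dz; rewrite /edge_weight; case: eqVneq => [e2|_] dz; last by apply: glip.
  rewrite /zero_edge; case: eqVneq => [ee|_]; last by apply: glip.
  rewrite addr0.
  suff [dz1 dv1] : g (d z) = m /\ g (d v) = m by rewrite dz1 dv1.
  have hends t : t = e \/ t = (e.1 + 1, e.2) -> g (d t) = m.
    by case: mM => ? ? ? ? ?; case=> ->; apply: gcol.
  have e1 : e.1 = Num.min v.1 z.1 by rewrite -ee.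
  have e2' : e.2 = v.2 by rewrite -ee.
  have : z.1 = v.1 + 1 \/ v.1 = z.1 + 1 by move: az; rewrite /adj; lia.
  case: (v) (z) e1 e2' e2 => [v1 v2] [z1 z2] /= e1 e2' <- [vz|vz].
    split; apply: hends; [right|left].
      by rewrite e1 e2' vz min_l//; lia.
    by rewrite [RHS]surjective_pairing e1 e2' min_l//; lia.
  split; apply: hends; [left|right].
    by rewrite [RHS]surjective_pairing e1 e2' min_r//; lia.
  by rewrite e1 e2' vz min_r//; lia.
have du : d u <= 0.
  by apply: restricted_time_le => //; exact: reach_refl.
have gu : g (d u) <= 0.
  have : 0 <= m by rewrite /m le_min; apply/andP; split; exact: restricted_time_ge0.
  case: mM; rewrite /g => *.
  case: (leP (d u) m); case: (leP (d u - M) 0); lra.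
apply/ler_addgt0Pr => eps eps0.
have [p [h1 h2 _] h3] := @restricted_time_near (zero_edge e hw) xpredT u w _ cT isT isT eps0.
have := pot _ _ h1; rewrite h2 => h4; have := gge (d w); rewrite /d in h4 *; lra.
Qed.

End RestrictedTime.

(** * Environments and the zero-one law *)

Section Environments.
Variable R : realType.
Implicit Types (s : seq pt) (A : pt -> set R).

Definition cylinder s A : set (pt -> R) := [set f | forall e, e \in s -> A e (f e)].

Definition cylinders : set (set (pt -> R)) :=
  [set C | exists s A, (forall e, measurable (A e)) /\ C = cylinder s A].

Definition env := g_sigma_algebraType cylinders.

Lemma cylinder_undup s A : cylinder (undup s) A = cylinder s A.
Proof. by apply/seteqP; split => f h e es; apply: h; rewrite ?mem_undup// -mem_undup. Qed.

Lemma measurable_cylinder s A : (forall e, measurable (A e)) ->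
  measurable (cylinder s A : set env).
Proof. by move=> mA; apply: sub_sigma_algebra; exists s, A. Qed.

Lemma cylinder_nil A : cylinder [::] A = setT.
Proof. by apply/seteqP; split. Qed.

Lemma cylinders_setI : setI_closed cylinders.
Proof.
move=> _ _ [s [A [mA ->]]] [s' [A' [mA' ->]]].
exists (s ++ s'), (fun e => (if e \in s then A e else setT) `&`
                            (if e \in s' then A' e else setT)); split.
  by move=> e; apply: measurableI; case: ifP.
apply/seteqP; split => f.
  by move=> [h h'] e _; split; case: ifP => // es; [exact: h|exact: h'].
move=> h; split=> e es; have := h e; rewrite mem_cat es ?orbT => /(_ isT) [].
  by [].
by [].
Qed.

(** Cylinders form a generating pi-system that contains the whole space, the cylinder over the empty
    list. Removing duplicates reduces the test to lists without repetition, for which [iid_law]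
    gives a product. *)
Lemma env_measure_unique (m1 m2 : {measure set env -> \bar R}) :
  (forall s A, uniq s -> (forall e, measurable (A e)) ->
    m1 (cylinder s A) = m2 (cylinder s A)) ->
  (m1 setT < +oo)%E ->
  forall B : set env, measurable B -> m1 B = m2 B.
Proof.
move=> h m1T B mB.
apply: (@measure_unique _ R env cylinders (fun=> setT)) => //.
- exact: cylinders_setI.
- by move=> _; exists [::], (fun=> setT); split=> //; rewrite cylinder_nil.
- by rewrite bigcup_const//; exists 0%N.
- move=> _ [s [A [mA ->]]]; rewrite -cylinder_undup; apply: h => //; exact: undup_uniq.
Qed.

Lemma measurable_env d (T : measurableType d) (X : T -> env) :
  (forall e, measurable_fun setT (fun w => X w e)) -> measurable_fun setT X.
Proof.
move=> mX; apply: (@measurability _ _ T env setT X cylinders) => //.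
move=> _ [_ [s [A [mA ->]]] <-]; rewrite setTI.
rewrite (_ : _ @^-1` _ = \bigcap_(e in [set` s]) ((fun w => X w e) @^-1` A e)).
  by apply: fin_bigcap_measurable => // e _; rewrite -[_ @^-1` _]setTI; exact: mX.
by apply/seteqP; split => w h e /=; exact: h.
Qed.

Lemma measurable_coord (e : pt) : measurable_fun setT (fun f : env => f e).
Proof.
move=> _ A mA; rewrite setTI.
rewrite (_ : _ @^-1` _ = cylinder [:: e] (fun=> A)); first exact: measurable_cylinder.
apply/seteqP; split => f /=; first by move=> h e'; rewrite inE => /eqP ->.
by move=> h; apply: (h e); rewrite inE.
Qed.

(** One product formula states both independence and the marginals, which are the case of
    one-element lists. *)
Definition iid_law (G : set R -> \bar R) (mu : set env -> \bar R) :=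
  forall s A, uniq s -> (forall e, measurable (A e)) ->
    mu (cylinder s A) = (\prod_(e <- s) G (A e))%E.

Definition shift_env (z : pt) (f : env) : env := fun e => f (e + z).

Lemma measurable_shift_env z : measurable_fun setT (shift_env z).
Proof. by apply: measurable_env => e; exact: measurable_coord. Qed.

(** Preimages under this map are events that do not look at the weights in [F]; they stand in for
    the sigma-algebra of the remaining coordinates. *)
Definition zero_edges (F : seq pt) (f : env) : env :=
  fun e => if e \in F then 0 else f e.

Lemma measurable_zero_edges F : measurable_fun setT (zero_edges F).
Proof.
apply: measurable_env => e; case: (boolP (e \in F)) => eF.
  rewrite (_ : (fun _ => _) = fun=> 0); first exact: measurable_cst.
  by apply/funext => f; rewrite /zero_edges eF.
rewrite (_ : (fun _ => _) = fun f : env => f e); first exact: measurable_coord.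
by apply/funext => f; rewrite /zero_edges (negbTE eF).
Qed.

Section Law.
Variables (G : set R -> \bar R) (mu : probability env R).
Hypothesis muG : iid_law G mu.

Lemma shift_invariant z (B : set env) : measurable B -> mu (shift_env z @^-1` B) = mu B.
Proof.
move=> mB; pose ms := isMeasurableFun.Build _ _ _ _ _ (measurable_shift_env z).
pose sh : {mfun env >-> env} := HB.pack (shift_env z) ms.
rewrite -[LHS]/(pushforward mu sh B).
apply: env_measure_unique => //=; last first.
  by rewrite /pushforward preimage_setT probability_setT ltry.
move=> s A us mA; rewrite muG// /pushforward.
rewrite (_ : _ @^-1` _ = cylinder [seq e + z | e <- s] (fun e => A (e - z))).
  rewrite muG//; last by rewrite map_inj_uniq//; exact: addIr.
  by rewrite big_map; apply: eq_bigr => e _; rewrite addrK.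
apply/seteqP; split => f h e.
  by move=> /mapP[e' e's ->]; rewrite addrK; exact: h.
move=> es; have := h (e + z); rewrite addrK; apply.
by rewrite (mem_map (@addIr _ z)).
Qed.

(** For a fixed cylinder over [s] both sides are finite measures in [B], so it suffices to compare
    them when [B] is a cylinder, where the product formula applies. *)
Lemma cylinder_indep s A (B : set env) : (forall e, measurable (A e)) -> measurable B ->
  mu (cylinder s A `&` zero_edges s @^-1` B) =
  (mu (cylinder s A) * mu (zero_edges s @^-1` B))%E.
Proof.
move=> mA mB; rewrite -(cylinder_undup s A).
have -> : zero_edges s = zero_edges (undup s).
  by apply/funext => f; apply/funext => e; rewrite /zero_edges mem_undup.
have := undup_uniq s; move: (undup s) => {}s us.
pose C : set env := cylinder s A; have mC : measurable C by exact: measurable_cylinder.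
pose mz := isMeasurableFun.Build _ _ _ _ _ (measurable_zero_edges s).
pose ze : {mfun env >-> env} := HB.pack (zero_edges s) mz.
have fC : mu C \is a fin_num by exact: fin_num_measure.
pose c : {nonneg R} := NngNum (fine_ge0 (measure_ge0 mu C)).
transitivity (pushforward (mrestr mu mC) ze B).
  by rewrite /pushforward /mrestr setIC.
transitivity (mscale c (distribution mu ze) B); last first.
  by rewrite /mscale /= fineK.
apply: env_measure_unique => //=; last first.
  rewrite /pushforward /mrestr preimage_setT setTI.
  by rewrite (le_lt_trans (probability_le1 _ _))// ltry.
move=> s' A' us' mA'; rewrite /mscale /= fineK// /distribution /pushforward /mrestr.
(* On [s] the erased environment is 0, so the constraints of [A'] there are either void or
   impossible. *)
have [h0|h0] := pselect (forall e, e \in s' -> e \in s -> A' e 0); last first.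
  have -> : zero_edges s @^-1` cylinder s' A' = set0.
    apply/seteqP; split => // f h; apply: h0 => e es' es.
    by have := h _ es'; rewrite /zero_edges es.
  by rewrite set0I !measure0 mule0.
pose s2 := [seq e <- s' | e \notin s].
have -> : zero_edges s @^-1` cylinder s' A' = cylinder s2 A'.
  apply/seteqP; split => f h e.
    by rewrite mem_filter => /andP[es es']; have := h _ es'; rewrite /zero_edges (negbTE es).
  move=> es'; rewrite /zero_edges; case: ifPn => es; first exact: h0.
  by apply: h; rewrite mem_filter es.
have -> : cylinder s2 A' `&` C = cylinder (s ++ s2) (fun e => if e \in s then A e else A' e).
  apply/seteqP; split => f.
    move=> [h1 h2] e; rewrite mem_cat; case: ifPn => /= es; first by move=> _; exact: h2.
    exact: h1.
  move=> h; split => e es; have := h e; rewrite mem_cat es ?orbT => /(_ isT); last by [].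
  by move: es; rewrite mem_filter => /andP[/negbTE ->].
have us2 : uniq s2 by exact: filter_uniq.
rewrite !muG//; last 2 first.
- rewrite cat_uniq us us2 andbT /=; apply/hasPn => e.
  by rewrite mem_filter => /andP[].
- by move=> e; case: ifP.
rewrite big_cat /=; congr (_ * _)%E.
  by rewrite big_seq [RHS]big_seq; apply: eq_bigr => e ->.
rewrite big_seq [RHS]big_seq; apply: eq_bigr => e.
by rewrite mem_filter => /andP[/negbTE ->].
Qed.

(** By iterating the invariance, [E] ignores any finite set of edges, hence is independent of every
    cylinder and then of every event. Independence of itself gives mu E = (mu E)^2. *)
Lemma zero_one_law (E : set env) : measurable E ->
  (forall e f, E f <-> E (zero_edge e f)) -> mu E = 0%E \/ mu E = 1%E.
Proof.
move=> mE inv.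
have zcons e F f : zero_edges (e :: F) f = zero_edge e (zero_edges F f).
  by apply/funext => e'; rewrite /zero_edges /zero_edge inE; case: eqVneq.
have invs F : zero_edges F @^-1` E = E.
  apply/seteqP; split => f; elim: F f => [|e F ih] f //=; rewrite zcons.
  - by move=> h; apply: ih; exact: (inv e _).2.
  - by move=> h; apply: (inv e _).1; exact: ih.
have fE : mu E \is a fin_num by exact: fin_num_measure.
pose c : {nonneg R} := NngNum (fine_ge0 (measure_ge0 mu E)).
have : mrestr mu mE E = mscale c mu E.
  apply: env_measure_unique => //=.
    move=> s A us mA; rewrite /mscale /= fineK// /mrestr.
    by rewrite -{1}(invs s) cylinder_indep// invs muleC.
  by rewrite /mrestr setTI (le_lt_trans (probability_le1 _ _))// ltry.
rewrite /mrestr /mscale /= setIid fineK//.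
move: fE; case: (mu E) => // r _; rewrite -EFinM => -[] h.
have /eqP : r * (r - 1) = 0 by rewrite mulrBr mulr1 -h subrr.
by rewrite mulf_eq0 subr_eq0 => /orP[] /eqP ->; [left|right].
Qed.

End Law.
End Environments.

(** * Integrability of passage times *)

Section Mean.
Context d (T : measurableType d) (R : realType) (mu : probability T R).
Implicit Types X Y : T -> R.

Definition mean X : \bar R := (\int[mu]_w (X w)%:E)%E.

Lemma mean_ge0 X : (forall w, 0 <= X w) -> (0 <= mean X)%E.
Proof. by move=> X0; apply: integral_ge0 => w _; rewrite lee_fin. Qed.

Lemma mean_le X Y : measurable_fun setT X -> measurable_fun setT Y ->
  (forall w, 0 <= X w) -> (forall w, X w <= Y w) -> (mean X <= mean Y)%E.
Proof.
move=> mX mY X0 XY; apply: ge0_le_integral => //.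
- by move=> w _; rewrite lee_fin.
- exact/measurable_EFinP.
- exact/measurable_EFinP.
- by move=> w _; rewrite lee_fin.
Qed.

Lemma mean_cst c : mean (cst c) = c%:E.
Proof.
rewrite -[LHS]/(\int[mu]_(w in setT) cst c%:E w)%E integral_cst//.
by rewrite [X in (_ * X)%E]probability_setT mule1.
Qed.

Lemma mean_add X Y : measurable_fun setT X -> measurable_fun setT Y ->
  (forall w, 0 <= X w) -> (forall w, 0 <= Y w) ->
  mean (fun w => X w + Y w) = (mean X + mean Y)%E.
Proof.
move=> mX mY X0 Y0; rewrite -ge0_integralD//.
- by move=> w _; rewrite lee_fin.
- exact/measurable_EFinP.
- by move=> w _; rewrite lee_fin.
- exact/measurable_EFinP.
Qed.

Lemma mean_scale c X : 0 <= c -> measurable_fun setT X -> (forall w, 0 <= X w) ->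
  mean (fun w => c * X w) = (c%:E * mean X)%E.
Proof.
move=> c0 mX X0; rewrite -ge0_integralZl//.
- exact/measurable_EFinP.
- by move=> w _; rewrite lee_fin.
Qed.

Lemma mean_sum n (X : nat -> T -> R) : (forall i, measurable_fun setT (X i)) ->
  (forall i w, 0 <= X i w) ->
  mean (fun w => \sum_(i < n) X i w) = (\sum_(i < n) mean (X i))%E.
Proof.
move=> mX X0; rewrite -ge0_integral_sum//.
- by apply: eq_integral => w _; rewrite sumEFin.
- by move=> i; exact/measurable_EFinP.
- by move=> i w _; rewrite lee_fin.
Qed.

End Mean.

(** * Times as random variables on environments: measurability and the cost of columns *)

Section Time.
Variable R : realType.
Implicit Types (P : pred int) (u w z : pt) (f : env R).

(* Taking absolute values keeps every time nonnegative without restricting the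
   environment space; under the law of the model it changes nothing a.s. *)
Definition time P u w f : R := restricted_time P (fun e => `|f e|) u w.

Definition strip (a b : int) : pred int := fun x => a <= x <= b.

Lemma col_convex_strip a b : col_convex (strip a b).
Proof. by move=> x y z; rewrite /strip; lia. Qed.

Lemma time_ge0 P u w f : 0 <= time P u w f.
Proof. exact: restricted_time_ge0. Qed.

Lemma time_triangle P z u w f : col_convex P -> P u.1 -> P z.1 -> P w.1 ->
  time P u w f <= time P u z f + time P z w f.
Proof. exact: restricted_time_triangle. Qed.

Lemma time_mono P P' u w f : (forall x, P x -> P' x) ->
  col_convex P -> P u.1 -> P w.1 -> time P' u w f <= time P u w f.
Proof. exact: restricted_time_mono. Qed.

Lemma time_vert P (x y y' : int) f : P x -> time P (x, y) (x, y') f <= `|y' - y|%:~R.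
Proof. exact: restricted_time_vert. Qed.

Lemma time_shift P u w z f :
  time P u w (shift_env z f) = time (fun x => P (x - z.1)) (u + z) (w + z) f.
Proof. exact: (restricted_time_shift P (fun e => `|f e|) u w z). Qed.

Lemma time_vert_end P u (x y y' : int) f : col_convex P -> P u.1 -> P x ->
  time P u (x, y') f <= time P u (x, y) f + `|y' - y|%:~R.
Proof.
move=> cP Pu Px; apply: le_trans (@time_triangle P (x, y) u (x, y') f cP Pu Px Px) _.
by rewrite lerD2l time_vert.
Qed.

Lemma measurable_path_time d (T : measurableType d) (hw : T -> pt -> R) u (p : seq pt) :
  (forall e, measurable_fun setT (hw ^~ e)) ->
  measurable_fun setT (fun t => path_time (hw t) u p).
Proof.
move=> mh; elim: p u => [|z p ih] v.
  rewrite (_ : (fun _ => _) = cst 0); first exact: measurable_cst.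
  by apply/funext => t; rewrite path_time_nil.
rewrite (_ : (fun _ => _) = (fun t => edge_weight (hw t) v z) \+
  (fun t => path_time (hw t) z p)); last first.
  by apply/funext => t; rewrite path_time_cons.
apply: measurable_funD => //.
case h : (v.2 == z.2).
  rewrite (_ : (fun _ => _) = hw ^~ (Num.min v.1 z.1, v.2))//.
  by apply/funext => t; rewrite /edge_weight h.
rewrite (_ : (fun _ => _) = cst 1); first exact: measurable_cst.
by apply/funext => t; rewrite /edge_weight h.
Qed.

(* The infimum is 0 where the path times are unbounded below, hence the set [U]. *)
Lemma measurable_restricted_time d (T : measurableType d) (hw : T -> pt -> R) P u w :
  (forall e, measurable_fun setT (hw ^~ e)) ->
  measurable_fun setT (fun t => restricted_time P (hw t) u w).
Proof.
move=> mh.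
have [[p0 hp0]|np] := pselect (exists p, col_path P u w p); last first.
  rewrite (_ : (fun _ => _) = cst 0); first exact: measurable_cst.
  apply/funext => t; rewrite /restricted_time (_ : col_path P u w = set0) ?image_set0 ?inf0//.
  by apply/seteqP; split => // p hp; apply: np; exists p.
(* Lists of points are countable, so the event [L x] that some admissible path costs less than [x]
   is a countable union. *)
pose F x n : set T := if unpickle n is Some p then
  (if `[< col_path P u w p >] then [set t | path_time (hw t) u p < x] else set0)
  else set0.
pose L x := \bigcup_n F x n.
have LP x t : L x t <-> exists2 p, col_path P u w p & path_time (hw t) u p < x.
  split=> [[n _]|[p hp hx]].
    rewrite /F; case: unpickle => // p; case: ifP => // /asboolP hp hx; by exists p.
  by exists (pickle p) => //; rewrite /F pickleK asboolT.
have mL x : measurable (L x).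
  apply: bigcupT_measurable => n; rewrite /F; case: unpickle => // p.
  case: ifP => // _; have := measurable_path_time u p mh measurableT (measurable_itv `]-oo, x[).
  by rewrite setTI; congr measurable; apply/seteqP; split => t; rewrite /= in_itv.
pose U := \bigcap_k L (- k%:R).
have mU : measurable U by exact: bigcapT_measurable.
apply: (measurability _ (RGenInftyO.measurableE R)) => _ [_ [x ->] <-]; rewrite setTI.
rewrite (_ : _ @^-1` _ = (if 0 < x then U else set0) `|` (L x `\` U)).
  by apply: measurableU; [case: ifP|exact: measurableD].
have S0 t : [set path_time (hw t) u p | p in col_path P u w] !=set0.
  by exists (path_time (hw t) u p0), p0.
have UE t : U t -> restricted_time P (hw t) u w = 0.
  move=> Ut; apply: inf_out => -[_ [b hb]].
  have /LP[p hp] := Ut (Num.truncn `|b|).+1 I.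
  apply/negP; rewrite -leNgt.
  apply: le_trans (hb _ (ex_intro2 _ _ p hp erefl)).
  by rewrite lerNl (le_trans (ler_norm _))// normrN ltW// truncnS_gt.
apply/seteqP; split => t; rewrite /= in_itv /=.
  have [Ut|nUt] := pselect (U t); first by rewrite UE// => ->; left.
  move=> /(inf_lt (S0 t)) [_ [p hp <-] hpx]; right; split => //.
  by apply/LP; exists p.
case; first by case: ifP => // x0 Ut; rewrite UE.
move=> [/LP[p hp hx] nUt]; apply: le_lt_trans hx; apply: ge_inf; last by exists p.
apply: contrapT => nlb; apply: nUt => k _; apply/LP; apply: contrapT => np.
apply: nlb; exists (- k%:R) => _ [p' hp' <-]; rewrite leNgt; apply/negP => h.
by apply: np; exists p'.
Qed.

Lemma measurable_time P u w : measurable_fun setT (time P u w).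
Proof.
apply: measurable_restricted_time => e.
by apply: measurableT_comp => //; exact: measurable_coord.
Qed.

Definition cross : env R -> R := time (strip 0 1) (0, 0) (1, 0).

(** Climb [j] rows, cross there, and come back down. *)
Lemma cross_le (j : nat) f : cross f <= 2 * j%:R + `|f (0, j%:Z)|.
Proof.
have -> : 2 * j%:R + `|f (0, j%:Z)| = `|j%:Z - 0|%:~R + `|f (0, j%:Z)| + `|0 - j%:Z|%:~R.
  have e1 : (`|j%:Z - 0| = j%:Z) by lia.
  have e2 : (`|0 - j%:Z| = j%:Z) by lia.
  by rewrite e1 e2 -!pmulrn mulr_natl mulr2n; ring.
apply: restricted_time_le => //; apply: reach_trans; last first.
  by apply: (@reach_vert _ _ _ 1 j%:Z 0).
apply: reach_trans; first by apply: (@reach_vert _ _ _ 0 0 j%:Z).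
by apply: (@reach_horiz _ _ _ 0 j%:Z).
Qed.

Lemma cross_shift P (x y : int) f : col_convex P -> P x -> P (x + 1) ->
  time P (x, y) (x + 1, y) f <= cross (shift_env (x, y) f).
Proof.
move=> cP Px Px1; rewrite /cross time_shift /=.
have -> : (0, 0) + (x, y) = (x, y) :> pt by congr pair; rewrite /= add0r.
have -> : (1, 0) + (x, y) = (x + 1, y) :> pt by congr pair; rewrite /= ?add0r 1?addrC.
apply: time_mono; rewrite /strip /=; [|by move=> ? ? ?; lia|lia|lia].
by move=> t ht; apply: (cP x _ (x + 1)) => //; lia.
Qed.

Lemma time_horiz P (n : nat) (x y : int) f : col_convex P -> P x -> P (x + n%:Z) ->
  time P (x, y) (x + n%:Z, y) f <= \sum_(i < n) cross (shift_env (x + i%:Z, y) f).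
Proof.
move=> cP Px; elim: n => [|n ih] Pn.
  by rewrite big_ord0 addr0 -[leRHS]/((`|0 : int|)%:~R) -(subrr y); exact: time_vert.
have Pn' : P (x + n%:Z) by apply: (cP x _ (x + n.+1%:Z)) => //; lia.
rewrite big_ord_recr /=.
apply: le_trans (@time_triangle P (x + n%:Z, y) (x, y) (x + n.+1%:Z, y) f cP Px Pn' Pn) _.
rewrite lerD ?ih//.
have -> : x + n.+1%:Z = x + n%:Z + 1 by lia.
by apply: cross_shift => //; move: Pn; congr (is_true (P _)); lia.
Qed.

Lemma time_bound P (n : nat) (x y y' : int) f : col_convex P -> P x -> P (x + n%:Z) ->
  time P (x, y) (x + n%:Z, y') f <=
  \sum_(i < n) cross (shift_env (x + i%:Z, y) f) + `|y' - y|%:~R.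
Proof.
move=> cP Px Pn; apply: le_trans (time_vert_end y y' f cP _ Pn) _ => //.
by rewrite lerD2r time_horiz.
Qed.

(** The bound is uniform in the endpoints, so one edge cannot affect linear growth. *)
Lemma time_zero_edge e u w f :
  `|time xpredT u w f - time xpredT u w (zero_edge e f)| <= `|f e|.
Proof.
have cT : col_convex xpredT by [].
have hz : (fun e' => `|zero_edge e f e'|) = zero_edge e (fun e' => `|f e'|).
  by apply/funext => e'; rewrite /zero_edge; case: eqVneq => //; rewrite normr0.
have h1 := @restricted_time_zero_edge R (fun e' => `|f e'|) e u w (fun=> normr_ge0 _).
have h2 : restricted_time xpredT (zero_edge e (fun e' => `|f e'|)) u w <=
          restricted_time xpredT (fun e' => `|f e'|) u w.
  by apply: restricted_time_le_weights => // e'; rewrite /zero_edge; case: ifP.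
by rewrite /time hz ler_norml; apply/andP; split; lra.
Qed.

Lemma time_zero_edge_out P e u w f : ~~ P e.1 -> time P u w (zero_edge e f) = time P u w f.
Proof.
move=> Pe; apply: restricted_time_local => x y Px _; rewrite /zero_edge.
by case: eqVneq => // exy; move: Pe; rewrite -exy Px.
Qed.

End Time.

(** * Finite expectations for an arbitrary weight law *)

Section Expectation.
Variables (R : realType) (G : probability R R) (mu : probability (env R) R).
Hypothesis muG : iid_law G mu.

Lemma mean_shift z (X : env R -> R) : measurable_fun setT X -> (forall f, 0 <= X f) ->
  mean mu (fun f => X (shift_env z f)) = mean mu X.
Proof.
move=> mX X0.
pose ms := isMeasurableFun.Build _ _ _ _ _ (@measurable_shift_env R z).
pose sh : {mfun env R >-> env R} := HB.pack (shift_env z) ms.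
have h := @ge0_integral_pushforward _ _ _ _ R sh (@measurable_shift_env R z) mu setT (EFin \o X) measurableT.
rewrite preimage_setT in h; rewrite -[LHS]h; last 2 first.
- exact/measurable_EFinP.
- by move=> f _; rewrite /= lee_fin.
apply: (@eq_measure_integral _ _ _ setT mu (distribution mu sh)) => B mB _.
exact: (shift_invariant muG z mB).
Qed.

(** Take [M] such that a weight exceeds [M] with probability at most 1/2. Crossing in the first row
    whose weight is at most [M] costs at most [M] plus twice the row number, and that row number has
    a geometric tail. The mean is at most [M + 2]. *)
Lemma mean_cross_lty : (mean mu (@cross R) < +oo)%E.
Proof.
have [M M0 hM] : exists2 M : R, 0 <= M & (G [set x | (M < `|x|)%R] <= (2^-1)%:E)%E.
  pose F n : set R := [set x | `|x| <= n%:R].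
  have mF n : measurable (F n).
    rewrite (_ : F n = [set` `[- n%:R, n%:R]])//.
    by apply/seteqP; split => x; rewrite /F /= in_itv /= ler_norml.
  have UF : \bigcup_n F n = setT.
    apply/seteqP; split => // x _; exists (Num.truncn `|x|).+1 => //=.
    exact/ltW/truncnS_gt.
  have cF : G \o F @ \oo --> G (\bigcup_n F n).
    apply: nondecreasing_cvg_mu => //; first by rewrite UF.
    move=> m n mn; apply/subsetPset => x /= h; apply: le_trans h _.
    by rewrite ler_nat.
  rewrite UF probability_setT in cF.
  have [n _ hn] : \forall n \near \oo, ((2^-1)%:E < G (F n))%E.
    apply: (cF [set y | ((2^-1)%:E < y)%E]); apply: open_ereal_gt'.
    by rewrite lte_fin; lra.
  exists n%:R => //.
  rewrite (_ : [set x | _] = ~` F n); last first.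
    by apply/seteqP; split => x /=; rewrite ?ltNge => /negP.
  rewrite probability_setC//; have := hn n (leqnn n).
  have : G (F n) \is a fin_num by exact: fin_num_measure.
  case: (G (F n)) => // r _; rewrite lte_fin -EFinB lee_fin; lra.
pose B : set R := [set x | M < `|x|].
have mB : measurable B.
  rewrite -[B]setTI.
  have := (@normr_measurable R setT) measurableT _ (measurable_itv `]M, +oo[).
  by rewrite set_itvE.
(* [C k] is the event that rows 0 to [k] are all heavier than [M]; the sum of the indicators is the
   number of the first light row. *)
pose s k : seq pt := [seq (0, i%:Z) | i <- iota 0 k.+1].
pose C k : set (env R) := cylinder (s k) (fun=> B).
have mC k : measurable (C k) by exact: measurable_cylinder.
have us k : uniq (s k).
  by rewrite map_inj_uniq ?iota_uniq// => i j -[].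
have muC k : (mu (C k) <= (1 / (2 ^ k.+1)%:R)%:E)%E.
  rewrite muG// big_map -[X in iota 0 X](subn0 k.+1) -/(index_iota 0 k.+1).
  elim: k.+1 => [|m ih]; first by rewrite big_geq// expn0 divr1.
  rewrite big_nat_recr//=.
  apply: le_trans (lee_pmul _ _ ih hM) _ => //.
    by apply: prode_ge0.
  by rewrite -EFinM lee_fin expnS natrM; lra.
have key f : ((cross f)%:E <= M%:E + 2%:E * \sum_(k <oo) (\1_(C k) f)%:E)%E.
  have [j hj Cj] : exists2 j : nat, cross f <= M + 2 * j%:R & forall k, (k < j)%N -> C k f.
    have [ex|nex] := pselect (exists j, `|f (0, j%:Z)| <= M).
      exists (ex_minn ex).
        by case: ex_minnP => j hj _; apply: le_trans (cross_le j f) _; lra.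
      case: ex_minnP => j _ hmin k kj e /mapP[i]; rewrite mem_iota add0n => /= hi ->.
      by rewrite /B /= ltNge; apply/negP => /hmin; lia.
    (* If no row is light, every [C k] occurs and any [j] with [2 * j] above [cross f] serves. *)
    exists (Num.truncn (cross f)).+1.
      by have := truncnS_gt (cross f); move: (_.+1%:R) => t; have : 0 <= cross f := time_ge0 _ _ _ _; lra.
    move=> k _ e /mapP[i _ ->]; rewrite /B /= ltNge; apply/negP => h; apply: nex.
    by exists i.
  apply: (@le_trans _ _ (M%:E + 2%:E * \sum_(0 <= k < j) (\1_(C k) f)%:E)%E); last first.
    rewrite leeD2l// lee_pmul2l//.
    by apply: nneseries_lim_ge => k _ _; rewrite lee_fin.
  rewrite (eq_big_nat _ _ (F2 := fun=> 1%E)); last first.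
    by move=> k /andP[_ kj]; rewrite indicE mem_set//; exact: Cj.
  by rewrite sumEFin -EFinM -EFinD lee_fin sumr_const_nat subn0.
have mI k : measurable_fun setT (fun f => (\1_(C k) f)%:E : \bar R).
  by apply/measurable_EFinP; exact: measurable_indic.
apply: (@le_lt_trans _ _ (\int[mu]_f (M%:E + 2%:E * \sum_(k <oo) (\1_(C k) f)%:E)))%E.
  apply: ge0_le_integral => //.
  - by move=> f _; rewrite lee_fin; exact: time_ge0.
  - by apply/measurable_EFinP; exact: measurable_time.
  - apply: emeasurable_funD => //; apply: measurable_funeM.
    by apply: ge0_emeasurable_sum => // k f _ _; rewrite lee_fin.
rewrite ge0_integralD//; last 2 first.
- by move=> f _; rewrite mule_ge0// nneseries_ge0// => k _ _; rewrite lee_fin.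
- apply: measurable_funeM.
  by apply: ge0_emeasurable_sum => // k f _ _; rewrite lee_fin.
rewrite [X in (X + _)%E](mean_cst mu M).
rewrite ge0_integralZl//; last 2 first.
- by apply: ge0_emeasurable_sum => // k f _ _; rewrite lee_fin.
- by move=> f _; rewrite nneseries_ge0// => k _ _; rewrite lee_fin.
rewrite integral_nneseries//.
apply: (@le_lt_trans _ _ (M%:E + 2%:E * 1%:E)%E); last by rewrite -EFinM -EFinD ltry.
rewrite leeD2l// lee_pmul2l//.
apply: le_trans (epsilon_trick0 xpredT ler01).
apply: lee_nneseries => [k _ _|k _]; first by apply: integral_ge0 => f _; rewrite lee_fin.
by rewrite integral_indic// setIT; exact: muC.
Qed.

Definition mean_cross : R := fine (mean mu (@cross R)).

Lemma mean_crossE : mean mu (@cross R) = mean_cross%:E.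
Proof.
rewrite fineK// ge0_fin_numE ?mean_cross_lty//.
by apply: mean_ge0 => f; exact: time_ge0.
Qed.

Lemma measurable_cross_shift z : measurable_fun setT (fun f : env R => cross (shift_env z f)).
Proof. by apply: measurableT_comp; [exact: measurable_time|exact: measurable_shift_env]. Qed.

Lemma mean_sum_cross (n : nat) (z : nat -> pt) :
  mean mu (fun f => \sum_(i < n) cross (shift_env (z i) f)) = (n%:R * mean_cross)%:E.
Proof.
rewrite (mean_sum mu n (X := fun i f => cross (shift_env (z i) f))).
- under eq_bigr => i _.
    rewrite mean_shift ?mean_crossE; [over|exact: measurable_time|by move=> f; exact: time_ge0].
  by rewrite sumEFin sumr_const card_ord mulr_natl.
- by move=> i; exact: measurable_cross_shift.
- by move=> i f; exact: time_ge0.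
Qed.

Lemma mean_time_le P (n : nat) (x y y' : int) : col_convex P -> P x -> P (x + n%:Z) ->
  (mean mu (time P (x, y) (x + n%:Z, y')%R) <= (n%:R * mean_cross + `|y' - y|%:~R)%:E)%E.
Proof.
move=> cP Px Pn.
have ms : measurable_fun setT (fun f : env R => \sum_(i < n) cross (shift_env (x + i%:Z, y) f)).
  by apply: measurable_sum => i; exact: measurable_cross_shift.
have s0 f : 0 <= \sum_(i < n) cross (R := R) (shift_env (x + i%:Z, y) f).
  by apply: sumr_ge0 => i _; exact: time_ge0.
have := mean_sum_cross n (fun i => (x + i%:Z, y)).
rewrite EFinD => <-; rewrite -(mean_cst mu (`|y' - y|%:~R)) -mean_add//.
apply: mean_le.
- exact: measurable_time.
- by apply: measurable_funD => //.
- by move=> f; exact: time_ge0.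
- by move=> f; exact: time_bound.
Qed.

End Expectation.

(** * Greedy chaining and subadditivity *)

Section Sequences.
Variable R : realType.

(* From a good index jump ahead over an interval of cost at most q per unit,
   from a bad one (or one within N of the end) advance by one. *)
Lemma greedy_bound (t : nat -> nat -> R) (D : nat -> R) (bad : pred nat) (q : R) (N m : nat) :
  (forall a b c, (a <= b <= c)%N -> (c <= m)%N -> t a c <= t a b + t b c) ->
  t m m <= 0 -> (forall i, 0 <= D i) ->
  (forall a, (a < m)%N -> t a a.+1 <= q + D a) ->
  (forall a, (a + N <= m)%N -> ~~ bad a ->
    exists2 n, (0 < n <= N)%N & t a (a + n)%N <= q * n%:R) ->
  t 0%N m <= q * m%:R + \sum_(i < m) (if bad i || (m < i + N)%N then D i else 0).
Proof.
move=> tri t0 D0 step good.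
pose F i := if bad i || (m < i + N)%N then D i else 0.
have F0 i : 0 <= F i by rewrite /F; case: ifP.
suff key k a : (a + k = m)%N -> t a m <= q * k%:R + \sum_(a <= i < m) F i.
  by have := key m 0%N (add0n m); rewrite big_mkord.
elim/ltn_ind: k a => k ih a akm.
case: (posnP k) => [k0|k0].
  have -> : a = m by lia.
  by rewrite k0 mulr0 add0r big_geq//; exact: t0.
case: (boolP (bad a || (m < a + N)%N)) => hb.
  have h : t a.+1 m <= q * k.-1%:R + \sum_(a.+1 <= i < m) F i by apply: ih; lia.
  have h1 := tri a a.+1 m; have h2 := step a.
  rewrite (@big_ltn _ _ _ a m)//; last by lia.
  rewrite {1}/F hb.
  have -> : k%:R = 1 + k.-1%:R :> R by rewrite -[1]/(1%:R) -natrD; congr _%:R; lia.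
  have {}h1 : t a m <= t a a.+1 + t a.+1 m by apply: h1; lia.
  have {}h2 : t a a.+1 <= q + D a by apply: h2; lia.
  by rewrite mulrDr mulr1; lra.
have [/negbTE nb naN] : ~~ bad a /\ (a + N <= m)%N by move: hb; rewrite negb_or; lia.
have [|n hn tn] := good a naN; first by rewrite nb.
have h : t (a + n)%N m <= q * (k - n)%:R + \sum_(a + n <= i < m) F i by apply: ih; lia.
have h1 : t a m <= t a (a + n)%N + t (a + n)%N m by apply: tri; lia.
rewrite (@big_cat_nat _ _ _ (a + n)%N) /=; [|by lia|by lia].
have s0 : 0 <= \sum_(a <= i < a + n) F i by apply: sumr_ge0 => i _.
have -> : k%:R = n%:R + (k - n)%:R :> R by rewrite -natrD; congr _%:R; lia.
by rewrite mulrDr; lra.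
Qed.

(** For [k = m] this says that at most [N] starting points are too close to the end for a jump. *)
Lemma sum_tail_le (k m N : nat) : (\sum_(i < k) (m < i + N) <= k + N - m)%N.
Proof.
elim: k => [|k ih]; first by rewrite big_ord0.
rewrite big_ord_recr /=; apply: leq_trans (leq_add ih (leqnn _)) _.
by case: ltnP; lia.
Qed.

(** The sequence [a n + C] is subadditive, so the limit is the infimum of [(a n + C) / n]. This also
    yields the bound valid for every [n]. For the upper bound, divide [n] by a nearly optimal [k]
    and bound all remainders by the constant [B]. *)
Lemma fekete (a : nat -> R) (C : R) : (forall n, 0 <= a n) -> 0 <= C ->
  (forall n m, a (n + m)%N <= a n + a m + C) ->
  exists L : R, [/\ 0 <= L, (fun n => a n / n%:R) @ \oo --> L &
    forall n, (0 < n)%N -> L * n%:R <= a n + C].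
Proof.
move=> a0 C0 sub.
pose S := [set (a n + C) / n%:R | n in [set n | (0 < n)%N]].
have S0 : S !=set0 by exists ((a 1%N + C) / 1), 1%N.
have lS : lbound S 0.
  by move=> _ [n _ <-]; rewrite divr_ge0// addr_ge0.
have hS : has_lbound S by exists 0.
pose L := inf S.
have LS n : (0 < n)%N -> L * n%:R <= a n + C.
  move=> n0; rewrite -ler_pdivlMr ?ltr0n//; apply: ge_inf => //; by exists n.
exists L; split => //; first exact: lb_le_inf.
apply/cvgrPdist_le => e e0.
have [|_ [k /= k0 <-] hk] := @inf_lt R S (L + e / 2) S0.
  by rewrite /L; lra.
have kR : 0 < k%:R :> R by rewrite ltr0n.
pose B := \sum_(r < k) a r.
have B0 : 0 <= B by apply: sumr_ge0.
have rB r : (r < k)%N -> a r <= B.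
  move=> rk; rewrite /B (bigD1 (Ordinal rk))//= lerDl; apply: sumr_ge0 => //.
have mult p r : (r < k)%N -> a (p * k + r)%N <= p%:R * (a k + C) + B.
  move=> rk; elim: p => [|p ih]; first by rewrite mul0r add0r mul0n add0n rB.
  have -> : (p.+1 * k + r = k + (p * k + r))%N by lia.
  by have := sub k (p * k + r)%N; rewrite -natr1; lra.
have [n0 hn0] : exists n0 : nat, B + C < e / 2 * n0%:R.
  exists (Num.truncn ((B + C) / (e / 2))).+1.
  by rewrite mulrC -ltr_pdivrMr ?truncnS_gt//; lra.
exists n0.+1 => // n /= n0n.
have nR : 0 < n%:R :> R by rewrite ltr0n; lia.
have hn : B + C < e / 2 * n%:R.
  by apply: lt_le_trans hn0 _; rewrite ler_pM2l ?ler_nat; [lia|lra].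
have e2n : e / 2 * n%:R <= e * n%:R by rewrite ler_pM2r//; lra.
rewrite distrC ler_norml; apply/andP; split.
  rewrite lerBrDr ler_pdivlMr//; have h : L * n%:R <= a n + C by apply: LS; lia.
  rewrite mulrDl mulNr; lra.
rewrite lerBlDr ler_pdivrMr//.
have := mult (n %/ k)%N (n %% k)%N (ltn_pmod n k0); rewrite -divn_eq => h.
have h2 : (n %/ k)%N%:R * (a k + C) <= (L + e / 2) * n%:R.
  move: hk; rewrite ltr_pdivrMr// => /ltW hk.
  apply: le_trans (ler_wpM2l (ler0n _ _) hk) _.
  rewrite mulrCA ler_wpM2l//.
    have : 0 <= L by exact: lb_le_inf.
    lra.
  by rewrite -natrM ler_nat; exact: leq_trunc_div.
rewrite mulrDl; move: h2; rewrite mulrDl; lra.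
Qed.

(* The margin 1/(j+1) makes this property invariant under bounded perturbations. *)
Definition io_below (u : nat -> R) (q : R) := exists j : nat,
  forall n0 : nat, exists2 n, (n0 <= n)%N & u n < (q - j.+1%:R^-1) * n%:R.

Lemma io_below_perturb (u u' : nat -> R) (q K : R) :
  (forall n, `|u n - u' n| <= K) -> io_below u q -> io_below u' q.
Proof.
(* The new index halves the margin; for large [n] the other half, times [n], exceeds [K]. *)
move=> h [j hj]; exists (j.*2.+1)%N => n0.
have c0 : 0 < (j.+1%:R^-1 : R) by rewrite invr_gt0.
have -> : (j.*2.+2%:R^-1 : R) = j.+1%:R^-1 / 2.
  by rewrite -doubleS -muln2 natrM invfM.
move: (j.+1%:R^-1) c0 hj => c c0 hj.
have [k hk] : exists k : nat, K < c / 2 * k%:R.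
  exists (Num.truncn (K / (c / 2))).+1.
  by rewrite mulrC -ltr_pdivrMr ?truncnS_gt//; lra.
have [n hn un] := hj (maxn n0 k); exists n; first by lia.
have kn : c / 2 * k%:R <= c / 2 * n%:R :> R.
  by rewrite ler_pM2l ?ler_nat; [lia|lra].
have := h n; rewrite ler_norml => /andP[h1 _].
move: un; rewrite !mulrBl; lra.
Qed.

End Sequences.

Lemma measurable_penalty d (T : measurableType d) (R : realType) (th : T -> T) (A : set T)
    (D : T -> R) (b : bool) :
  measurable_fun setT th -> measurable A -> measurable_fun setT D ->
  measurable_fun setT (fun w => if (th w \notin A) || b then D (th w) else 0).
Proof.
move=> mth mA mD; have comp (Y : T -> R) : measurable_fun setT Y ->
    measurable_fun setT (fun w => Y (th w)) by move=> mY; exact: measurableT_comp.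
case: b.
  rewrite (_ : (fun _ => _) = fun w => D (th w)); first exact: comp.
  by apply/funext => w; rewrite orbT.
rewrite (_ : (fun _ => _) = fun w => (D \* \1_(~` A)) (th w)).
  apply: comp; apply: measurable_funM => //.
  by apply: measurable_indic; exact: measurableC.
apply/funext => w; rewrite /= orbF indicE in_setC.
by case: (_ \notin A); rewrite ?mulr1 ?mulr0.
Qed.

(** * Expected penalty of a greedy chain under measure-preserving maps *)

Section GreedyMean.
Context d (T : measurableType d) (R : realType) (mu : probability T R).
Variable theta : nat -> T -> T.
Hypothesis mtheta : forall i, measurable_fun setT (theta i).
Hypothesis theta_inv : forall i (X : T -> R), measurable_fun setT X ->
  (forall w, 0 <= X w) -> mean mu (fun w => X (theta i w)) = mean mu X.

(** By invariance each index contributes the mean of [D] off the good set [A]; the at most [N]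
    indices near the end are charged the full mean of [D]. *)
Lemma greedy_mean (A : set T) (D : T -> R) (N m : nat) : measurable A ->
  measurable_fun setT D -> (forall w, 0 <= D w) ->
  (mean mu (fun w => \sum_(i < m)
     (if (theta i w \notin A) || (m < i + N)%N then D (theta i w) else 0))%R <=
   m%:R%:E * mean mu (fun w => D w * \1_(~` A) w)%R + N%:R%:E * mean mu D)%E.
Proof.
move=> mA mD D0.
pose X w := D w * \1_(~` A) w.
have mX : measurable_fun setT X.
  by apply: measurable_funM => //; apply: measurable_indic; exact: measurableC.
have X0 w : 0 <= X w by rewrite mulr_ge0// indicE.
have comp i (Y : T -> R) : measurable_fun setT Y -> measurable_fun setT (fun w => Y (theta i w)).
  by move=> mY; apply: measurableT_comp => //.
pose Y i w := X (theta i w) + (m < i + N)%N%:R * D (theta i w).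
have mY i : measurable_fun setT (Y i).
  apply: measurable_funD; first exact: comp.
  by apply: measurable_funM => //; exact: comp.
have Y0 i w : 0 <= Y i w by rewrite addr_ge0// mulr_ge0// ler0n.
pose Z i w := if (theta i w \notin A) || (m < i + N)%N then D (theta i w) else 0.
have mZ i : measurable_fun setT (Z i) by exact: measurable_penalty.
have Z0 i w : 0 <= Z i w by rewrite /Z; case: ifP.
apply: (@le_trans _ _ (mean mu (fun w => \sum_(i < m) Y i w))).
  apply: mean_le.
  - by apply: measurable_sum => i; exact: (mZ i).
  - by apply: measurable_sum => i; exact: mY.
  - by move=> w; apply: sumr_ge0 => i _; exact: (Z0 i).
  move=> w; apply: ler_sum => i _; rewrite /Y /X indicE in_setC.
  have := D0 (theta i w); case: (_ \notin A); case: (m < i + N)%N => /=; lra.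
rewrite mean_sum//.
have meanY i : mean mu (Y i) = (mean mu X + (m < i + N)%N%:R%:E * mean mu D)%E.
  rewrite mean_add//; last 3 first.
  - exact: comp.
  - by apply: measurable_funM => //; exact: comp.
  - by move=> w; rewrite mulr_ge0// ler0n.
  rewrite theta_inv// mean_scale//; last exact: comp.
  by rewrite theta_inv.
under eq_bigr do rewrite meanY.
rewrite big_split /=; apply: leeD.
  by rewrite sumr_const card_ord mule_natl.
rewrite -ge0_sume_distrl; last by move=> i _; rewrite lee_fin ler0n.
apply: lee_wpmul2r; first exact: mean_ge0.
rewrite sumEFin lee_fin -natr_sum ler_nat.
by apply: leq_trans (sum_tail_le m m N) _; lia.
Qed.

End GreedyMean.

(** * The zero-one law for linear growth rates *)

Section Dichotomy.
Variables (R : realType) (G : probability R R) (mu : probability (env R) R).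
Hypothesis muG : iid_law G mu.
Variable u : nat -> env R -> R.
Hypothesis mu_u : forall n, measurable_fun setT (u n).

Lemma measurable_lt_cst (X : env R -> R) c : measurable_fun setT X ->
  measurable [set f | X f < c].
Proof.
move=> mX; have := mX measurableT _ (measurable_itv `]-oo, c[).
by rewrite setTI; congr measurable; apply/seteqP; split => f; rewrite /= in_itv.
Qed.

Lemma measurable_io_below q : measurable [set f : env R | io_below (u ^~ f) q].
Proof.
rewrite (_ : [set f | _] = \bigcup_j \bigcap_n0 \bigcup_n
  (if (n0 <= n)%N then [set f | u n f < (q - j.+1%:R^-1) * n%:R] else set0)).
  apply: bigcupT_measurable => j; apply: bigcapT_measurable => n0.
  apply: bigcupT_measurable => n; case: ifP => // _; exact: measurable_lt_cst.
apply/seteqP; split => f.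
  move=> [j hj]; exists j => // n0 _; have [n hn un] := hj n0.
  by exists n => //; rewrite hn.
move=> [j _ hj]; exists j => n0; have [n _] := hj n0 I.
by case: ifP => // hn un; exists n.
Qed.

(** The constant [K] may depend on the edge and the environment but not on [n], which is what
    [io_below_perturb] absorbs. *)
Lemma io_below_dichotomy q :
  (forall e f, exists K, forall n, `|u n f - u n (zero_edge e f)| <= K) ->
  mu [set f | io_below (u ^~ f) q] = 0%E \/ mu [set f | io_below (u ^~ f) q] = 1%E.
Proof.
move=> h; apply: (zero_one_law muG); first exact: measurable_io_below.
move=> e f; have [K hK] := h e f; split; apply: io_below_perturb => n.
  exact: hK.
by rewrite distrC; exact: hK.
Qed.

End Dichotomy.

(** * The speed and its convexity *)

Section Elementary.
Variable R : realType.

Lemma le_of_linear (x y B : R) :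
  (forall n : nat, (0 < n)%N -> x * n%:R <= y * n%:R + B) -> x <= y.
Proof.
move=> h; rewrite leNgt; apply/negP => yx.
have d0 : 0 < x - y by lra.
pose n := (Num.truncn (B / (x - y))).+1.
have hn : B < (x - y) * n%:R by rewrite mulrC -ltr_pdivrMr ?truncnS_gt.
by have := h n isT; move: hn; rewrite mulrBl; lra.
Qed.

Lemma linear_bound (a : nat -> R) (L e : R) : (forall n, 0 <= a n) -> 0 <= L -> 0 < e ->
  (fun n => a n / n%:R) @ \oo --> L ->
  exists2 B, 0 <= B & forall n, a n <= (L + e) * n%:R + B.
Proof.
move=> a0 L0 e0 /cvgrPdist_le /(_ e e0) [n0 _ hn0].
exists (\sum_(i < n0.+1) a i); first exact: sumr_ge0.
move=> n; have [nn0|nn0] := leqP n n0.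
  have nn1 : (n < n0.+1)%N by lia.
  rewrite (bigD1 (Ordinal nn1))//= addrCA lerDl addr_ge0//; last exact: sumr_ge0.
  by rewrite mulr_ge0// addr_ge0// ltW.
have nR : 0 < n%:R :> R by rewrite ltr0n; lia.
have := hn0 n (ltnW nn0); rewrite /= distrC ler_norml => /andP[_].
rewrite lerBlDr ler_pdivrMr// => h.
have : 0 <= \sum_(i < n0.+1) a i by exact: sumr_ge0.
by move: h; rewrite (addrC L); lra.
Qed.

Lemma ceil_bounds (x : R) : x <= (Num.ceil x)%:~R < x + 1.
Proof.
by have := ceil_itv x; rewrite intrB => /andP[h1 h2]; apply/andP; split; lra.
Qed.

Lemma ceil_dist (x y : R) : (`|Num.ceil x - Num.ceil y|%:~R : R) <= `|x - y| + 1.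
Proof.
rewrite intr_norm intrB; have := ceil_bounds x; have := ceil_bounds y.
move: (Num.ceil x)%:~R (Num.ceil y)%:~R => X Y /andP[h1 h2] /andP[h3 h4].
by rewrite ler_norml; apply/andP; split; case: (ger0P (x - y)) => h; lra.
Qed.

Lemma ceil_dist3 (z x y : R) :
  (`|Num.ceil z - (Num.ceil x + Num.ceil y)|%:~R : R) <= `|z - x - y| + 2.
Proof.
rewrite intr_norm intrB intrD.
have := ceil_bounds x; have := ceil_bounds y; have := ceil_bounds z.
move: (Num.ceil x)%:~R (Num.ceil y)%:~R (Num.ceil z)%:~R => X Y Z.
move=> /andP[h1 h2] /andP[h3 h4] /andP[h5 h6].
by rewrite ler_norml; apply/andP; split; case: (ger0P (z - x - y)) => h; lra.
Qed.

(** The bookkeeping of [speed_convex]: terms linear in [n] are separated from constants, so that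
    [le_of_linear] can discard the latter. *)
Lemma convex_arith (sa sb sv t n k l e Ba Bb C ma mb mv : R) :
  0 <= sa -> 0 <= sb -> 0 < e -> k <= t * n -> l <= (1 - t) * n + 1 ->
  sv * n <= mv + 2 -> mv <= ma + mb + C ->
  ma <= (sa + e) * k + Ba -> mb <= (sb + e) * l + Bb ->
  sv * n <= (t * sa + (1 - t) * sb + e) * n + (Ba + Bb + (sb + e) + C + 2).
Proof.
move=> sa0 sb0 e0 hk hl.
have h1 : (sa + e) * k <= (sa + e) * (t * n) by apply: ler_wpM2l => //; lra.
have h2 : (sb + e) * l <= (sb + e) * ((1 - t) * n + 1) by apply: ler_wpM2l => //; lra.
have -> : (t * sa + (1 - t) * sb + e) * n =
  (sa + e) * (t * n) + (sb + e) * ((1 - t) * n + 1) - (sb + e) by ring.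
lra.
Qed.

End Elementary.

Definition target (R : realType) (v : R) (n : nat) : pt := (n%:Z, Num.ceil (v * n%:R)).

Section Blocks.
Variable R : realType.
Implicit Types (P : pred int) (f : env R) (z : pt).

Lemma target0 (v : R) : target v 0 = (0, 0).
Proof. by rewrite /target mulr0 ceil0. Qed.

Lemma shift_env_comp z z' f : shift_env z (shift_env z' f) = shift_env (z + z') f.
Proof. by apply/funext => e; rewrite /shift_env addrA. Qed.

(** A path in the strip around the origin, translated to start at [z], stays in the columns
    [z.1 + a] to [z.1 + b], all of which lie in [P]. *)
Lemma time_block P (a b : int) (l : nat) (y : int) z f : a <= 0 -> l%:Z <= b ->
  col_convex P -> P (z.1 + a) -> P (z.1 + b) ->
  time P z (z + (l%:Z, y)) f <= time (strip a b) (0, 0) (l%:Z, y) (shift_env z f).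
Proof.
move=> a0 lb cP Pa Pb; rewrite time_shift.
have -> : (0, 0) + z = z by rewrite [LHS]add0r.
rewrite (addrC _ z); apply: time_mono; rewrite /strip /=.
- by move=> x hx; apply: (cP (z.1 + a) _ (z.1 + b)) => //; lia.
- by move=> ? ? ?; lia.
- by lia.
- by lia.
Qed.

End Blocks.

Section Speed.
Variables (R : realType) (G : probability R R) (mu : probability (env R) R).
Hypothesis muG : iid_law G mu.

Lemma mean_time_fin P (n : nat) (x y y' : int) : col_convex P -> P x -> P (x + n%:Z) ->
  mean mu (time P (x, y) (x + n%:Z, y')) \is a fin_num.
Proof.
move=> cP Px Pn; rewrite ge0_fin_numE; last by apply: mean_ge0 => f; exact: time_ge0.
exact: le_lt_trans (mean_time_le muG _ _ cP Px Pn) (ltry _).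
Qed.

Definition strip_mean (v : R) (n : nat) : R :=
  fine (mean mu (time (strip 0 n%:Z) (0, 0) (target v n))).

Lemma strip_meanE v n :
  mean mu (time (strip 0 n%:Z) (0, 0) (target v n)) = (strip_mean v n)%:E.
Proof.
rewrite /strip_mean fineK//.
have := @mean_time_fin (strip 0 n%:Z) n 0 0 (Num.ceil (v * n%:R)) (@col_convex_strip _ _).
by rewrite add0r; apply; rewrite /strip; lia.
Qed.

Lemma strip_mean_ge0 v n : 0 <= strip_mean v n.
Proof. by apply: fine_ge0; apply: mean_ge0 => f; exact: time_ge0. Qed.

(** Follow slope [a] for [k] columns, then slope [b] for [l] columns, and correct the height in the
    last column. Equal slopes give subadditivity, different slopes give convexity. *)
Lemma strip_mean_concat a b v (k l : nat) : strip_mean v (k + l) <=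
  strip_mean a k + strip_mean b l +
  `|Num.ceil (v * (k + l)%:R) - (Num.ceil (a * k%:R) + Num.ceil (b * l%:R))|%:~R.
Proof.
set c : R := `|_|%:~R; rewrite -lee_fin !EFinD -!strip_meanE.
have c0 : 0 <= c by rewrite ler0z.
pose z := target a k.
have mt P u w : measurable_fun setT (time (R := R) P u w) by exact: measurable_time.
have t0 P u w f : 0 <= time (R := R) P u w f by exact: time_ge0.
have ms : measurable_fun setT (fun f : env R =>
    time (strip 0 l%:Z) (0, 0) (target b l) (shift_env z f)).
  by apply: measurableT_comp; [exact: mt|exact: measurable_shift_env].
rewrite -(mean_shift muG z (mt (strip 0 l%:Z) (0, 0) (target b l)) (t0 _ _ _)).
rewrite -(mean_cst mu c) -mean_add// -mean_add//; last 2 first.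
- exact: measurable_funD.
- by move=> f; rewrite addr_ge0.
apply: mean_le => //.
  by apply: measurable_funD => //; exact: measurable_funD.
move=> f /=; rewrite -[X in strip 0 X]/((k + l)%N%:Z) {1}/target.
pose P := strip 0 (k + l)%N%:Z.
have cP : col_convex P by exact: col_convex_strip.
have P0 : P 0 by rewrite /P /strip; lia.
have Pk : P k%:Z by rewrite /P /strip; lia.
have Pkl : P (k + l)%N%:Z by rewrite /P /strip; lia.
apply: le_trans (@time_vert_end R P (0, 0) _ (Num.ceil (a * k%:R) + Num.ceil (b * l%:R)) _ f cP P0 Pkl) _.
rewrite lerD2r; apply: le_trans (@time_triangle R P z (0, 0) (_, _) f cP P0 Pk Pkl) _.
apply: lerD.
  apply: time_mono => /=; [|exact: col_convex_strip|by rewrite /strip; lia..].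
  by move=> x; rewrite /P /strip; lia.
have -> : ((k + l)%N%:Z, Num.ceil (a * k%:R) + Num.ceil (b * l%:R)) = z + target b l.
  by rewrite /z /target PoszD.
by apply: time_block => //=; rewrite addr0.
Qed.

Lemma strip_mean_sub v n m : strip_mean v (n + m) <= strip_mean v n + strip_mean v m + 2.
Proof.
apply: le_trans (strip_mean_concat v v v n m) _; rewrite lerD2l.
apply: le_trans (ceil_dist3 _ _ _) _.
by rewrite natrD mulrDr (_ : _ - _ - _ = 0) ?normr0 ?add0r//; ring.
Qed.

Definition speed (v : R) : R := lim ((fun n => strip_mean v n / n%:R) @ \oo).

Lemma speedP v : [/\ 0 <= speed v, (fun n => strip_mean v n / n%:R) @ \oo --> speed v &
  forall n, (0 < n)%N -> speed v * n%:R <= strip_mean v n + 2].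
Proof.
have [L [L0 cL hL]] := fekete (strip_mean_ge0 v) (ler0n R 2) (strip_mean_sub v).
by rewrite /speed; have /cvg_lim -> := cL.
Qed.

(** Spend the integer part [k] of [t * n] columns on slope [a] and the remaining [l] on slope [b].
    The final height misses the target by at most [|a - b| + 2], a constant. *)
Lemma speed_convex : convex_on_nonneg speed.
Proof.
move=> a b t a0 b0 /andP[t0 t1]; set v := t * a + (1 - t) * b.
have [sa0 sac _] := speedP a; have [sb0 sbc _] := speedP b; have [_ _ hv] := speedP v.
apply/ler_addgt0Pr => e e0.
have [Ba Ba0 hBa] := linear_bound (strip_mean_ge0 a) sa0 e0 sac.
have [Bb Bb0 hBb] := linear_bound (strip_mean_ge0 b) sb0 e0 sbc.
apply: (@le_of_linear _ _ _ (Ba + Bb + (speed b + e) + (`|a - b| + 2) + 2)) => n n0.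
have tn0 : 0 <= t * n%:R by rewrite mulr_ge0.
have [k [k1 k2 kn]] : exists k : nat, [/\ k%:R <= t * n%:R, t * n%:R < k%:R + 1 & (k <= n)%N].
  have kt : (Num.truncn (t * n%:R))%:R <= t * n%:R by rewrite truncn_le.
  exists (Num.truncn (t * n%:R)); split => //; first by rewrite natr1 truncnS_gt.
  by rewrite -(ler_nat R) (le_trans kt)// ler_piMl.
have [l nkl] : exists l, n = (k + l)%N by exists (n - k)%N; rewrite subnKC.
have lR : l%:R = n%:R - k%:R :> R by rewrite nkl natrD addrC addKr.
have hs := hv n n0; have hc := strip_mean_concat a b v k l.
have hd : (`|Num.ceil (v * (k + l)%:R) - (Num.ceil (a * k%:R) + Num.ceil (b * l%:R))|%:~R : R)
    <= `|a - b| + 2.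
  apply: le_trans (ceil_dist3 _ _ _) _; rewrite lerD2r -nkl lR.
  have -> : v * n%:R - a * k%:R - b * (n%:R - k%:R) = (a - b) * (t * n%:R - k%:R).
    by rewrite /v; ring.
  rewrite normrM ler_piMr// ger0_norm ?subr_ge0// lerBlDr addrC; exact: ltW.
move: hc; rewrite -nkl => hc.
apply: (convex_arith sa0 sb0 e0 k1 _ hs _ (hBa k) (hBb l)).
  by rewrite lR mulrBl mul1r -addrA lerD2l -lerBlDl opprK addrC lerBlDr addrC ltW.
by rewrite -nkl in hd; apply: le_trans hc _; rewrite lerD2l.
Qed.

End Speed.

(** * Lower bound *)

(** Dominated convergence, since the complements of [A N] shrink to a null set. It fixes a jump
    range [N] for which the expected penalty per bad index is at most [eta]. *)
Lemma mean_bad_small d (T : measurableType d) (R : realType) (mu : probability T R)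
    (A : nat -> set T) (D : T -> R) (eta : R) :
  (forall N, measurable (A N)) -> (forall M N, (M <= N)%N -> A M `<=` A N) ->
  mu (\bigcup_N A N) = 1%E -> measurable_fun setT D -> (forall w, 0 <= D w) ->
  (mean mu D < +oo)%E -> 0 < eta ->
  exists N, (mean mu (fun w => D w * \1_(~` A N) w)%R <= eta%:E)%E.
Proof.
move=> mA ndA A1 mD D0 Dfin eta0.
pose F N w : \bar R := (D w * \1_(~` A N) w)%:E.
have mF N : measurable_fun setT (F N).
  apply/measurable_EFinP; apply: measurable_funM => //.
  by apply: measurable_indic; exact: measurableC.
have mU : measurable (\bigcup_N A N) by exact: bigcupT_measurable.
have iD : mu.-integrable setT (EFin \o D).
  apply/integrableP; split; first exact/measurable_EFinP.
  under eq_integral do rewrite /= ger0_norm//.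
  exact: Dfin.
have F0 : {ae mu, forall w, setT w -> F ^~ w @ \oo --> (cst 0%E : T -> \bar R) w}.
  exists (~` \bigcup_N A N); split; first exact: measurableC.
    by rewrite probability_setC// A1 subee.
  move=> w /=; apply: contra_not => -[M _ AM] _.
  apply: cvg_near_cst; exists M => // N /= MN; rewrite /F indicE in_setC.
  by rewrite mem_set ?mulr0//; exact: (ndA M).
have dom : {ae mu, forall w N, setT w -> (`|F N w| <= (EFin \o D) w)%E}.
  apply: aeW => w N _; rewrite /F /= lee_fin ger0_norm; last by rewrite mulr_ge0// indicE.
  by rewrite ler_piMr// indicE; case: (_ \in _).
have [_ _] := dominated_convergence measurableT mF (measurable_cst _) F0 iD dom.
rewrite integral0 => h.
have [N _ hN] : \forall N \near \oo, (mean mu (fun w => D w * \1_(~` A N) w)%R < eta%:E)%E.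
  apply: (h [set y | (y < eta%:E)%E]); apply: open_ereal_lt'.
  by rewrite lte_fin.
by exists N; apply: ltW; exact: (hN N (leqnn N)).
Qed.

Lemma strip_of_path (u : pt) (p : seq pt) :
  exists N : nat, all (fun z : pt => strip (- N%:Z) N%:Z z.1) (u :: p).
Proof.
elim: p u => [|z p ih] u.
  by exists (absz u.1); rewrite /= andbT /strip; lia.
have [N hN] := ih z; exists (maxn N (absz u.1)).
rewrite [all _ _]/=; apply/andP; split; first by rewrite /strip; lia.
by apply: sub_all hN => t; rewrite /strip; lia.
Qed.

Section Lower.
Variables (R : realType) (G : probability R R) (mu : probability (env R) R).
Hypothesis muG : iid_law G mu.
Variable v : R.
Hypothesis v0 : 0 <= v.

(** The origin has a jump over [n] columns of cost below [q * n]. The bound [N] on length and strip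
    keeps jumps local; the bound [n0] from below makes rounding errors small relative to [n]. *)
Definition good_set (q : R) (n0 N : nat) : set (env R) :=
  [set f | exists2 n, (n0 <= n <= N)%N &
    time (strip (- N%:Z) N%:Z) (0, 0) (target v n) f < q * n%:R].

Lemma measurable_good_set q n0 N : measurable (good_set q n0 N).
Proof.
rewrite (_ : good_set q n0 N = \bigcup_n (if (n0 <= n <= N)%N then
  [set f | time (strip (- N%:Z) N%:Z) (0, 0) (target v n) f < q * n%:R] else set0)).
  apply: bigcupT_measurable => n; case: ifP => // _.
  by apply: measurable_lt_cst; exact: measurable_time.
apply/seteqP; split => f.
  by move=> [n hn h]; exists n => //; rewrite hn.
by move=> [n _]; case: ifP => // hn h; exists n.
Qed.

Lemma good_set_mono q n0 M N : (M <= N)%N -> good_set q n0 M `<=` good_set q n0 N.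
Proof.
move=> MN f [n hn h]; exists n; first by lia.
apply: le_lt_trans h; apply: time_mono => /=.
- by move=> x; rewrite /strip; lia.
- exact: col_convex_strip.
- by rewrite /strip; lia.
- by rewrite /strip; lia.
Qed.

(** The price of advancing the target by one column: a column crossing plus a vertical correction of
    at most [v + 1]. *)
Definition detour (f : env R) : R := cross f + (v + 1).

Lemma detour_ge0 f : 0 <= detour f.
Proof. by rewrite addr_ge0 ?addr_ge0//; exact: time_ge0. Qed.

Lemma measurable_detour : measurable_fun setT detour.
Proof. by apply: measurable_funD => //; exact: measurable_time. Qed.

Lemma mean_detour : mean mu detour = (mean_cross mu + (v + 1))%:E.
Proof.
rewrite /detour mean_add.
- by rewrite (mean_crossE muG) mean_cst.
- exact: measurable_time.
- exact: measurable_cst.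
- by move=> f; exact: time_ge0.
- by move=> f; rewrite addr_ge0.
Qed.

(** [greedy_bound] between the points [target v a]. A jump lands within 2 of the next target, which
    is the 2 in the hypothesis, and may back up by [N] columns, so the strip starts at [- N]. *)
Lemma greedy_time (q q' : R) (n0 N m : nat) f : 0 <= q' -> (0 < n0)%N ->
  (forall n, (n0 <= n)%N -> q * n%:R + 2 <= q' * n%:R) ->
  time (strip (- N%:Z) (m + N)%N%:Z) (0, 0) (target v m) f <= q' * m%:R +
  \sum_(i < m) (if (shift_env (target v i) f \notin good_set q n0 N) || (m < i + N)%N
                then detour (shift_env (target v i) f) else 0).
Proof.
move=> q'0 n00 qq'.
pose P := strip (- N%:Z) (m + N)%N%:Z.
have cP : col_convex P by exact: col_convex_strip.
have Pa a : (a <= m)%N -> P a%:Z by rewrite /P /strip; lia.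
have := @greedy_bound R (fun a b => time P (target v a) (target v b) f)
  (fun i => detour (shift_env (target v i) f))
  (fun i => shift_env (target v i) f \notin good_set q n0 N) q' N m.
rewrite target0; apply.
- by move=> a b c abc cm; apply: time_triangle => //=; apply: Pa; lia.
- by have := @time_vert R P m%:Z (Num.ceil (v * m%:R)) (Num.ceil (v * m%:R)) f (Pa m (leqnn m));
    rewrite subrr.
- by move=> i; exact: detour_ge0.
- move=> a am.
  have Pa0 : P a%:Z by apply: Pa; lia.
  have Pa1 : P (a%:Z + 1) by rewrite -[_ + _]/(a%:Z + 1%:Z) -PoszD addn1; apply: Pa; lia.
  have aE : a.+1%:Z = a%:Z + 1 by lia.
  rewrite /target aE.
  apply: le_trans (@time_vert_end R P (_, _) _ (Num.ceil (v * a%:R)) _ f cP Pa0 Pa1) _.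
  have h1 := @cross_shift R P a%:Z (Num.ceil (v * a%:R)) f cP Pa0 Pa1.
  have h2 := ceil_dist (v * a.+1%:R) (v * a%:R).
  have e3 : `|v * a.+1%:R - v * a%:R| = v.
    by rewrite -mulrBr -natrB// subSnn mulr1 ger0_norm.
  rewrite e3 in h2; rewrite /detour.
  apply: le_trans (lerD h1 h2) _.
  by rewrite lerDr.
move=> a aN; rewrite negbK inE => -[n hn hlt].
exists n; first by lia.
have Pan : P (a + n)%N%:Z by apply: Pa; lia.
have Pa0 : P a%:Z by apply: Pa; lia.
apply: le_trans (@time_vert_end R P (_, _) _ (Num.ceil (v * a%:R) + Num.ceil (v * n%:R)) _ f cP Pa0 Pan) _.
have h1 : time P (target v a) ((a + n)%N%:Z, Num.ceil (v * a%:R) + Num.ceil (v * n%:R)) f <=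
    time (strip (- N%:Z) N%:Z) (0, 0) (target v n) (shift_env (target v a) f).
  have -> : ((a + n)%N%:Z, Num.ceil (v * a%:R) + Num.ceil (v * n%:R)) = target v a + target v n.
    by rewrite /target PoszD.
  apply: time_block => //=; rewrite /P /strip; lia.
have h2 := ceil_dist3 (v * (a + n)%:R) (v * a%:R) (v * n%:R).
have e3 : v * (a + n)%:R - v * a%:R - v * n%:R = 0 by rewrite natrD; ring.
rewrite e3 normr0 add0r in h2.
apply: le_trans (lerD (le_trans h1 (ltW hlt)) h2) _.
by apply: qq'; lia.
Qed.

(** Shifting by [N] columns makes the chain fit into the strip of an actual [strip_mean]. The [N]
    columns added at each end are crossed one by one and the height is corrected at the end; all
    this costs a constant independent of [m]. *)
Lemma strip_mean_greedy (q q' eta : R) (n0 N m : nat) : 0 <= q' -> (0 < n0)%N ->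
  (forall n, (n0 <= n)%N -> q * n%:R + 2 <= q' * n%:R) ->
  (mean mu (fun f => detour f * \1_(~` good_set q n0 N) f)%R <= eta%:E)%E ->
  strip_mean mu v (N + (m + N)) <= (q' + eta) * m%:R +
    (N%:R * (mean_cross mu + (v + 1)) + N%:R * mean_cross mu + N%:R * mean_cross mu
     + (v * (N + N)%:R + 1)).
Proof.
move=> q'0 n00 qq' heta.
pose A := good_set q n0 N.
pose P := strip (- N%:Z) (m + N)%N%:Z.
have cP : col_convex P by exact: col_convex_strip.
pose bad f : R := \sum_(i < m) (if (shift_env (target v i) f \notin A) || (m < i + N)%N
                then detour (shift_env (target v i) f) else 0).
pose S1 f : R := \sum_(i < N) cross (shift_env (- N%:Z + i%:Z, 0) f).
pose S2 f : R := \sum_(i < N) cross (shift_env (m%:Z + i%:Z, Num.ceil (v * m%:R)) f).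
pose c : R := v * (N + N)%:R + 1.
have mth i : measurable_fun setT (@shift_env R (target v i)) by exact: measurable_shift_env.
have mbad : measurable_fun setT bad.
  apply: measurable_sum => i; apply: measurable_penalty => //.
    exact: measurable_good_set.
  exact: measurable_detour.
have bad0 f : 0 <= bad f by apply: sumr_ge0 => i _; case: ifP => // _; exact: detour_ge0.
have mS z : measurable_fun setT (fun f : env R => \sum_(i < N) cross (shift_env (z i) f)).
  by apply: measurable_sum => i; exact: measurable_cross_shift.
have S0 z f : 0 <= \sum_(i < N) cross (R := R) (shift_env (z i) f).
  by apply: sumr_ge0 => i _; exact: time_ge0.
have c0 : 0 <= c by rewrite addr_ge0// mulr_ge0.
have q'm0 : 0 <= q' * m%:R by rewrite mulr_ge0.
have key f : time (strip 0 (N + (m + N))%N%:Z) (0, 0) (target v (N + (m + N)))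
    (shift_env (- N%:Z, 0) f) <= q' * m%:R + bad f + S1 f + S2 f + c.
  rewrite time_shift.
  have -> : (0, 0) + (- N%:Z, 0) = (- N%:Z, 0) :> pt by rewrite [LHS]add0r.
  have -> : target v (N + (m + N)) + (- N%:Z, 0) =
      (m%:Z + N%:Z, Num.ceil (v * (N + (m + N))%:R)).
    by rewrite /target; congr pair; rewrite /= ?addr0//; lia.
  rewrite (_ : (fun x => strip _ _ _) = P); last first.
    by apply/funext => x; rewrite /P /strip /=; lia.
  have PN : P (- N%:Z) by rewrite /P /strip; lia.
  have P0 : P 0 by rewrite /P /strip; lia.
  have Pm : P m%:Z by rewrite /P /strip; lia.
  have PmN : P (m%:Z + N%:Z) by rewrite /P /strip; lia.
  apply: le_trans (@time_triangle R P (target v m) (_, _) (_, _) f cP PN Pm PmN) _.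
  have h1 := @time_triangle R P (0, 0) (- N%:Z, 0) (target v m) f cP PN P0 Pm.
  have h2 : time P (- N%:Z, 0) (0, 0) f <= S1 f.
    have := @time_horiz R P N (- N%:Z) 0 f cP PN; rewrite addNr; exact.
  have h3 := @greedy_time q q' n0 N m f q'0 n00 qq'.
  have h4 := @time_bound R P N m%:Z (Num.ceil (v * m%:R)) (Num.ceil (v * (N + (m + N))%:R)) f cP Pm PmN.
  have h5 := ceil_dist (v * (N + (m + N))%:R) (v * m%:R).
  have e5 : `|v * (N + (m + N))%:R - v * m%:R| = v * (N + N)%:R.
    by rewrite (addnCA N) natrD mulrDr addrAC subrr add0r ger0_norm// mulr_ge0.
  rewrite e5 in h5.
  rewrite -/P -/(bad f) in h3; rewrite -/(S2 f) in h4; rewrite -/c in h5.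
  apply: le_trans (lerD (le_trans h1 (lerD h2 h3)) (le_trans h4 (lerD (lexx _) h5))) _.
  rewrite [leLHS](_ : _ = q' * m%:R + bad f + S1 f + S2 f + c)//; ring.
have mt P' u w : measurable_fun setT (time (R := R) P' u w) by exact: measurable_time.
have mS1 : measurable_fun setT S1 by exact: mS.
have mS2 : measurable_fun setT S2 by exact: mS.
have S10 f : 0 <= S1 f by exact: S0.
have S20 f : 0 <= S2 f by exact: S0.
have m1 : measurable_fun setT (fun f => q' * m%:R + bad f) by exact: measurable_funD.
have m2 : measurable_fun setT (fun f => q' * m%:R + bad f + S1 f) by exact: measurable_funD.
have m3 : measurable_fun setT (fun f => q' * m%:R + bad f + S1 f + S2 f).
  exact: measurable_funD.
have p1 f : 0 <= q' * m%:R + bad f by exact: addr_ge0.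
have p2 f : 0 <= q' * m%:R + bad f + S1 f by exact: addr_ge0.
have p3 f : 0 <= q' * m%:R + bad f + S1 f + S2 f by exact: addr_ge0.
have h : ((strip_mean mu v (N + (m + N)))%:E <=
    mean mu (fun f => q' * m%:R + bad f + S1 f + S2 f + c)%R)%E.
  rewrite -(strip_meanE muG) -(mean_shift muG (- N%:Z, 0) (mt _ _ _) (time_ge0 _ _ _)).
  apply: mean_le.
  - by apply: measurableT_comp; [exact: mt|exact: measurable_shift_env].
  - exact: measurable_funD.
  - by move=> f; exact: time_ge0.
  - exact: key.
rewrite (@mean_add _ _ _ mu _ _ m3 (measurable_cst c) p3 (fun=> c0)) in h.
rewrite (@mean_add _ _ _ mu _ _ m2 mS2 p2 S20) in h.
rewrite (@mean_add _ _ _ mu _ _ m1 mS1 p1 S10) in h.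
rewrite (@mean_add _ _ _ mu _ _ (measurable_cst (q' * m%:R)) mbad (fun=> q'm0) bad0) in h.
rewrite !mean_cst in h.
rewrite (@mean_sum_cross _ _ _ muG N (fun i => (- N%:Z + i%:Z, 0))) in h.
rewrite (@mean_sum_cross _ _ _ muG N (fun i => (m%:Z + i%:Z, Num.ceil (v * m%:R)))) in h.
have hb : (mean mu bad <= (m%:R * eta)%:E + (N%:R * (mean_cross mu + (v + 1)))%:E)%E.
  apply: le_trans (@greedy_mean _ _ _ mu (fun i => shift_env (target v i)) mth _ A detour N m _ _ _) _.
  - by move=> i X mX X0; exact: (mean_shift muG).
  - exact: measurable_good_set.
  - exact: measurable_detour.
  - exact: detour_ge0.
  by rewrite mean_detour -EFinM leeD2r// EFinM lee_wpmul2l// lee_fin.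
rewrite -lee_fin; apply: le_trans h _.
apply: (@le_trans _ _ ((q' * m%:R)%:E +
    ((m%:R * eta)%:E + (N%:R * (mean_cross mu + (v + 1)))%:E) +
    (N%:R * mean_cross mu)%:E + (N%:R * mean_cross mu)%:E + c%:E)%E).
  by do 3 apply: leeD => //; apply: leeD.
rewrite -!EFinD lee_fin le_eqVlt; apply/orP; left; apply/eqP; rewrite /c; ring.
Qed.

Lemma lower_tail q : q < speed mu v ->
  mu [set f | io_below (fun n => time xpredT (0, 0) (target v n) f) q] = 0%E.
Proof.
move=> qs.
have pert (e : pt) (f : env R) : exists K, forall n, `|time xpredT (0, 0) (target v n) f -
    time xpredT (0, 0) (target v n) (zero_edge e f)| <= K.
  by exists `|f e| => n; exact: time_zero_edge.
have [//|mu1] := io_below_dichotomy muG (u := fun n => time xpredT (0, 0) (target v n))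
  (fun n => @measurable_time R _ _ _) q pert.
exfalso; set E := [set f | _] in mu1.
(* Times are nonnegative, so for [q <= 0] the event would be empty. *)
have q0 : 0 < q.
  have [f [j hj]] : E !=set0.
    by apply/set0P/eqP => E0; move: mu1; rewrite E0 measure0 => -[] /eqP; rewrite eq_sym oner_eq0.
  have [n _ hn] := hj 1%N.
  rewrite ltNge; apply/negP => q0.
  have := le_lt_trans (time_ge0 _ _ _ _) hn; apply/negP; rewrite -leNgt.
  rewrite mulr_le0_ge0// subr_le0 (le_trans q0)// invr_ge0//.
(* One third of the gap pays for rounding, one for the bad columns; the last gives the
   contradiction. *)
pose dl := (speed mu v - q) / 3.
have dl0 : 0 < dl by rewrite /dl; lra.
have [n0 n00 hn0] : exists2 n0 : nat, (0 < n0)%N & 2 <= dl * n0%:R.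
  exists (Num.truncn (2 / dl)).+1 => //.
  by rewrite mulrC -ler_pdivrMr// ltW// truncnS_gt.
have qq' n : (n0 <= n)%N -> q * n%:R + 2 <= (q + dl) * n%:R.
  move=> nn; rewrite mulrDl lerD2l (le_trans hn0)// ler_pM2l// ler_nat//.
have A1 : mu (\bigcup_N good_set q n0 N) = 1%E.
  apply/eqP; rewrite eq_le; apply/andP; split.
    by apply: probability_le1; apply: bigcupT_measurable => N; exact: measurable_good_set.
  rewrite -mu1; apply: le_measure; rewrite ?inE.
  - apply: measurable_io_below => n; exact: measurable_time.
  - by apply: bigcupT_measurable => N; exact: measurable_good_set.
  (* A time below [q * n] is witnessed by a finite path, which lies in some strip, so the good sets
     exhaust the event. *)
  move=> f [j hj]; have [n hn hlt] := hj n0.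
  have {}hlt : time xpredT (0, 0) (target v n) f < q * n%:R.
    by apply: lt_le_trans hlt _; rewrite ler_wpM2r// lerBlDr lerDl invr_ge0.
  have [p [h1 h2 _] h3] := @restricted_time_lt R _ xpredT _ _ _ (fun _ _ _ _ _ _ _ => isT) isT isT hlt.
  have [N hN] := strip_of_path (0, 0) p.
  exists (maxn N n) => //; exists n; first by lia.
  apply: le_lt_trans h3; apply: restricted_time_le => //; exists p => //; split => //.
  by apply: sub_all hN => z; rewrite /strip; lia.
have [|N hN] := @mean_bad_small _ _ _ mu (good_set q n0) detour dl
  (measurable_good_set q n0) (@good_set_mono q n0) A1 measurable_detour detour_ge0 _ dl0.
  by rewrite mean_detour ltry.
have [s0 _ hs] := speedP muG v.
have : speed mu v <= q + dl + dl.
  apply: (@le_of_linear _ _ _ ((N%:R * (mean_cross mu + (v + 1)) + N%:R * mean_cross mu +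
    N%:R * mean_cross mu + (v * (N + N)%:R + 1)) + 2)) => m m0.
  have h1 := hs (N + (m + N))%N; have h2 := strip_mean_greedy m _ n00 qq' hN.
  have {}h1 : speed mu v * (N + (m + N))%:R <= strip_mean mu v (N + (m + N)) + 2 by apply: h1; lia.
  have {}h2 := h2 (ltW (addr_gt0 q0 dl0)).
  rewrite addrA.
  apply: le_trans (le_trans h1 (lerD h2 (lexx 2))).
  by rewrite ler_wpM2l// ler_nat; lia.
by rewrite /dl; lra.
Qed.

End Lower.

(** * Upper bound *)

Lemma not_io_below (R : realType) (u : nat -> R) (q e : R) : ~ io_below u q -> 0 < e ->
  exists n0 : nat, forall n, (n0 <= n)%N -> (q - e) * n%:R <= u n.
Proof.
move=> h e0; pose j := Num.truncn e^-1.
have je : j.+1%:R^-1 <= e.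
  by rewrite invf_ple ?posrE// ltW// truncnS_gt.
apply: contrapT => hn; apply: h; exists j => n0; apply: contrapT => hn0.
apply: hn; exists n0 => n nn0; rewrite leNgt; apply/negP => un; apply: hn0.
by exists n => //; apply: lt_le_trans un _; rewrite ler_wpM2r// lerD2l lerN2.
Qed.

(** In [upper_block], [cn] is the rounded value of [p1 = v * n], [p2 = v * r] is the part of the
    spare columns, [p3 = v * M], [p4 = k * (v * M)], and [p5] is the height reached by [k] rounded
    blocks. *)
Lemma ceil_arith (R : realType) (cn p1 p2 p3 p4 p5 k : R) : 0 <= k -> p1 = p2 + p4 ->
  p1 <= cn -> cn < p1 + 1 -> p4 <= p5 -> p5 <= p4 + k -> 0 <= p2 -> p2 <= p3 ->
  `|cn - p5| <= k + (p3 + 1).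
Proof. by move=> *; rewrite ler_norml; apply/andP; split; lra. Qed.

(** The final chain of [upper_block]: [tr] is the time over the spare columns, [tc] the time along
    the blocks, [bs] their sum, [dd] the height correction, [s] the mean of one block. *)
Lemma upper_arith (R : realType) (t1 t2 tr tc bs dd s k B aB W vM x : R) :
  t1 <= t2 + dd -> t2 <= tr + tc -> tc <= bs -> bs <= (s + 1) * k + B -> B <= aB ->
  dd <= k + vM -> (s + 2) * k <= x -> tr + aB <= W -> t1 <= x + (W + vM).
Proof. by move=> *; lra. Qed.

Section Upper.
Variables (R : realType) (G : probability R R) (mu : probability (env R) R).
Hypothesis muG : iid_law G mu.

Lemma ae_not_io_below (u : nat -> env R -> R) q : (forall n, measurable_fun setT (u n)) ->
  mu [set f | io_below (u ^~ f) q] = 0%E -> {ae mu, forall f, ~ io_below (u ^~ f) q}.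
Proof.
move=> m_u h; exists [set f | io_below (u ^~ f) q]; split => //.
  exact: measurable_io_below.
by move=> f /=; apply: contrapT.
Qed.

Lemma ae_shift (Q : env R -> Prop) z : {ae mu, forall f, Q f} ->
  {ae mu, forall f, Q (shift_env z f)}.
Proof.
move=> [N [mN N0 hN]]; exists (shift_env z @^-1` N); split.
- by rewrite -[X in measurable X]setTI; exact: (@measurable_shift_env R z measurableT).
- by rewrite [LHS](shift_invariant muG z mN).
- by move=> f nQ; apply: hN.
Qed.

Variable v : R.
Hypothesis v0 : 0 <= v.

Section Block.
Variable M : nat.
Hypothesis M0 : (0 < M)%N.

Definition block_time (f : env R) : R := time (strip 0 M%:Z) (0, 0) (target v M) f.

(** The height is a multiple of the rounded height of one block, not the rounded multiple: corners
    are additive and all blocks are exact translates of the first. *)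
Definition corner (i : nat) : pt := ((i * M)%N%:Z, i%:Z * Num.ceil (v * M%:R)).

Definition block_sum (k : nat) (f : env R) : R :=
  \sum_(i < k) block_time (shift_env (corner i) f).

Lemma cornerD i j : corner (i + j) = corner i + corner j.
Proof. by rewrite /corner; congr pair; rewrite /=; [rewrite mulnDl PoszD|rewrite PoszD mulrDl]. Qed.

Lemma corner1 : corner 1 = target v M.
Proof. by rewrite /corner mul1n mul1r. Qed.

Lemma block_time_ge0 f : 0 <= block_time f.
Proof. exact: time_ge0. Qed.

Lemma measurable_block_shift i :
  measurable_fun setT (fun f : env R => block_time (shift_env (corner i) f)).
Proof. by apply: measurableT_comp; [exact: measurable_time|exact: measurable_shift_env]. Qed.

Lemma measurable_block_sum k : measurable_fun setT (block_sum k).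
Proof. by apply: measurable_sum => i; exact: measurable_block_shift. Qed.

Lemma block_sum_ge0 k f : 0 <= block_sum k f.
Proof. by apply: sumr_ge0 => i _; exact: block_time_ge0. Qed.

Lemma mean_block_sum k : mean mu (block_sum k) = (k%:R * strip_mean mu v M)%:E.
Proof.
rewrite /block_sum (mean_sum mu k (X := fun i f => block_time (shift_env (corner i) f))).
- under eq_bigr => i _.
    rewrite (mean_shift muG) ?(strip_meanE muG); [over|exact: measurable_time|].
    by move=> f; exact: time_ge0.
  by rewrite sumEFin sumr_const card_ord mulr_natl.
- exact: measurable_block_shift.
- by move=> i f; exact: block_time_ge0.
Qed.

(** Block [i] uses no column left of [i * M], so the edge [e] can change only blocks with
    [i <= |e.1|]. The sign is reversed because [io_below] detects small values and large sums are at
    issue. *)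
Lemma block_sum_perturb e f :
  exists K, forall k, `|- block_sum k f - - block_sum k (zero_edge e f)| <= K.
Proof.
pose g i : R := `|block_time (shift_env (corner i) f) -
              block_time (shift_env (corner i) (zero_edge e f))|.
pose i0 := (absz e.1).+1.
have g0 i : (i0 <= i)%N -> g i = 0.
  move=> hi; apply/eqP; rewrite normr_eq0 subr_eq0; apply/eqP.
  rewrite /block_time !time_shift; symmetry; apply: time_zero_edge_out.
  have iM : (i <= i * M)%N by exact: leq_pmulr.
  move: hi; rewrite /corner /strip /i0 /=; move: (i * M)%N iM => iM; lia.
exists (\sum_(i < i0) g i) => k.
rewrite opprK addrC distrC -sumrB.
apply: le_trans (ler_norm_sum _ _ _) _.
rewrite -(big_mkord xpredT g) -(big_mkord xpredT g).
have [ki|ik] := leqP k i0.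
  by rewrite [leRHS](@big_cat_nat _ _ _ k)//= lerDl sumr_ge0// => i _; exact: normr_ge0.
rewrite [leLHS](@big_cat_nat _ _ _ i0)//=; last exact: ltnW.
rewrite [X in _ + X](_ : _ = 0) ?addr0// big_nat_cond big1// => i /andP[/andP[hi _] _].
exact: g0.
Qed.

(** Some run of at most [N] blocks from the origin has average above [C]: the good jumps for the
    negated sums. *)
Definition heavy_set (C : R) (N : nat) : set (env R) :=
  [set f | exists2 n, (0 < n <= N)%N & - block_sum n f < - C * n%:R].

Lemma measurable_heavy_set C N : measurable (heavy_set C N).
Proof.
rewrite (_ : heavy_set C N = \bigcup_n (if (0 < n <= N)%N then
  [set f | - block_sum n f < - C * n%:R] else set0)).
  apply: bigcupT_measurable => n; case: ifP => // _.
  by apply: measurable_lt_cst; apply: measurableT_comp => //; exact: measurable_block_sum.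
apply/seteqP; split => f.
  by move=> [n hn h]; exists n => //; rewrite hn.
by move=> [n _]; case: ifP => // hn h; exists n.
Qed.

Lemma heavy_set_mono C N N' : (N <= N')%N -> heavy_set C N `<=` heavy_set C N'.
Proof. by move=> NN f [n hn h]; exists n => //; lia. Qed.

(** [greedy_bound] for the negated sums at rate [- C]. A single block contributes at most
    [0 = - C + C], so the penalty is the constant [C]. *)
Lemma greedy_block C N m f : 0 <= C -> C * m%:R <= block_sum m f +
  \sum_(i < m) (if (shift_env (corner i) f \notin heavy_set C N) || (m < i + N)%N
                then C else 0).
Proof.
move=> C0; pose X i := block_time (shift_env (corner i) f).
have := @greedy_bound R (fun a b => - \sum_(a <= i < b) X i) (fun=> C)
  (fun i => shift_env (corner i) f \notin heavy_set C N) (- C) N m.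
rewrite big_mkord -/(block_sum m f) => h.
suff : - block_sum m f <= - C * m%:R + \sum_(i < m)
    (if (shift_env (corner i) f \notin heavy_set C N) || (m < i + N)%N then C else 0).
  by clear h; rewrite mulNr => h; lra.
apply: h => //.
- by move=> a b c /andP[ab bc] _; rewrite -opprD -big_cat_nat.
- by rewrite big_geq// oppr0.
- by move=> a _; rewrite big_nat1 addNr oppr_le0; exact: block_time_ge0.
move=> a aN; rewrite negbK inE => -[n hn /ltW hlt]; exists n => //.
apply: le_trans hlt; rewrite lerN2 le_eqVlt; apply/orP; left; apply/eqP; symmetry.
rewrite /block_sum -{1}[a]add0n big_addn addKn big_mkord; apply: eq_bigr => i _.
by rewrite /X cornerD shift_env_comp.
Qed.

(** Otherwise the event has probability 1 and almost every environment starts a heavy run. Chaining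
    these runs makes the mean of [block_sum m] at least about [C * m], whereas it equals [m] times
    the smaller [strip_mean]. *)
Lemma block_upper C : strip_mean mu v M < C ->
  mu [set f | io_below (fun k => - block_sum k f) (- C)] = 0%E.
Proof.
move=> XC; have C0 : 0 < C by exact: le_lt_trans (strip_mean_ge0 _ _ _) XC.
have mu_u k : measurable_fun setT (fun f => - block_sum k f).
  by apply: measurableT_comp => //; exact: measurable_block_sum.
have [//|mu1] := io_below_dichotomy muG mu_u (- C) block_sum_perturb.
exfalso; set E := [set f | _] in mu1.
have mH N : measurable (heavy_set C N) by exact: measurable_heavy_set.
have A1 : mu (\bigcup_N heavy_set C N) = 1%E.
  apply/eqP; rewrite eq_le; apply/andP; split.
    by apply: probability_le1; exact: bigcupT_measurable.
  rewrite -mu1; apply: le_measure; rewrite ?inE.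
  - exact: (measurable_io_below mu_u).
  - exact: bigcupT_measurable.
  move=> f [j hj]; have [n hn hlt] := hj 1%N.
  exists n => //; exists n; first by rewrite hn leqnn.
  by apply: lt_le_trans hlt _; rewrite ler_wpM2r// lerBlDr lerDl invr_ge0.
pose eta := (C - strip_mean mu v M) / 2.
have eta0 : 0 < eta by rewrite divr_gt0// subr_gt0.
have [|N hN] := @mean_bad_small _ _ _ mu (heavy_set C) (cst C) eta
  mH (@heavy_set_mono C) A1 (measurable_cst C) (fun=> ltW C0) _ eta0.
  by rewrite mean_cst ltry.
suff : C <= strip_mean mu v M + eta.
  by rewrite /eta; move: (strip_mean mu v M) XC => s; lra.
apply: (@le_of_linear _ _ _ (N%:R * C)) => m _.
pose bad f : R := \sum_(i < m) (if (shift_env (corner i) f \notin heavy_set C N) ||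
  (m < i + N)%N then C else 0).
have mbad : measurable_fun setT bad.
  apply: measurable_sum => i.
  by apply: (@measurable_penalty _ _ _ _ _ (cst C)) => //; exact: measurable_shift_env.
have bad0 f : 0 <= bad f by apply: sumr_ge0 => i _; case: ifP => // _; exact: ltW.
have h : ((C * m%:R)%:E <= mean mu (fun f => block_sum m f + bad f)%R)%E.
  rewrite -(mean_cst mu (C * m%:R)); apply: mean_le => //.
  - by apply: measurable_funD => //; exact: measurable_block_sum.
  - by move=> f; rewrite mulr_ge0// ltW.
  - by move=> f; apply: greedy_block; exact: ltW.
rewrite (@mean_add _ _ _ mu _ _ (measurable_block_sum m) mbad (block_sum_ge0 m) bad0) in h.
rewrite mean_block_sum in h.
have hb : (mean mu bad <= (m%:R * eta)%:E + (N%:R * C)%:E)%E.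
  apply: le_trans (@greedy_mean _ _ _ mu (fun i => shift_env (corner i)) _ _
    (heavy_set C N) (cst C) N m _ _ _) _ => //.
  - by move=> i; exact: measurable_shift_env.
  - by move=> i X mX X0; exact: (mean_shift muG).
  - by move=> f; exact: ltW.
  by rewrite mean_cst -EFinM leeD2r// EFinM lee_wpmul2l// lee_fin.
rewrite -lee_fin; apply: le_trans h _.
apply: le_trans (leeD (lexx _) hb) _.
rewrite -!EFinD lee_fin le_eqVlt; apply/orP; left; apply/eqP; ring.
Qed.

(** The slack of 1 per block is harmless, as it is later divided by the block length [M]. Half of it
    is spent on [block_upper], half on the margin in [not_io_below]. *)
Lemma block_sum_ae : {ae mu, forall f, exists B, forall k,
  block_sum k f <= (strip_mean mu v M + 1) * k%:R + B}.
Proof.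
have sC : strip_mean mu v M < strip_mean mu v M + 2^-1.
  by rewrite ltrDl invr_gt0.
have mu_u k : measurable_fun setT (fun f => - block_sum k f).
  by apply: measurableT_comp => //; exact: measurable_block_sum.
have h := ae_not_io_below mu_u (block_upper sC).
apply: filterS h => f h.
have h2 : 0 < 2^-1 :> R by rewrite invr_gt0.
have [k0 hk0] := not_io_below h h2.
have s0 := strip_mean_ge0 mu v M.
exists (block_sum k0 f) => k; have [kk|kk] := leqP k0 k.
  have := hk0 k kk; have := block_sum_ge0 k0 f.
  have -> : - (strip_mean mu v M + 2^-1) - 2^-1 = - (strip_mean mu v M + 1) by field.
  by rewrite mulNr; move: (block_sum k f) (block_sum k0 f) (_ * _) => a b c; lra.
rewrite -[leLHS]add0r lerD//; first by rewrite mulr_ge0// addr_ge0.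
rewrite /block_sum -(big_mkord xpredT (fun i => block_time (shift_env (corner i) f))).
rewrite -(big_mkord xpredT (fun i => block_time (shift_env (corner i) f))).
rewrite [leRHS](@big_cat_nat _ _ _ k)//=; last exact: ltnW.
by rewrite lerDl sumr_ge0// => i _; exact: block_time_ge0.
Qed.

Lemma time_chain k z f :
  time xpredT z (z + corner k) f <= block_sum k (shift_env z f).
Proof.
elim: k => [|k ih].
  have -> : z + corner 0 = z by rewrite /corner mul0n mul0r [LHS]addr0.
  rewrite /block_sum big_ord0; case: z => x y.
  by have := @time_vert R xpredT x y y f isT; rewrite subrr.
rewrite /block_sum big_ord_recr /=.
apply: le_trans (@time_triangle R xpredT (z + corner k) _ _ f _ isT isT isT) _ => //.
rewrite lerD// shift_env_comp -addn1 cornerD corner1 addrA (addrC (corner k)).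
exact: (@time_block R xpredT 0 M%:Z M (Num.ceil (v * M%:R)) (z + corner k) f).
Qed.

(* For n = r + k M the r spare columns are crossed before the k blocks, so each residue
   r needs only one almost sure bound. *)
Lemma upper_block : {ae mu, forall f, exists B, forall n,
  time xpredT (0, 0) (target v n) f <= (strip_mean mu v M + 2) / M%:R * n%:R + B}.
Proof.
have h : {ae mu, forall f, forall r : nat, exists B, forall k,
    block_sum k (shift_env (r%:Z, 0) f) <= (strip_mean mu v M + 1) * k%:R + B}.
  by apply: ae_foralln => r; exact: (ae_shift (r%:Z, 0) block_sum_ae).
apply: filterS h => f /choice[B hB].
have s0 := strip_mean_ge0 mu v M.
have MR : 0 < M%:R :> R by rewrite ltr0n.
pose W r := time xpredT (0, 0) (r%:Z, 0) f + `|B r|.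
have W0 r : 0 <= W r by rewrite addr_ge0//; exact: time_ge0.
exists (\sum_(r < M) W r + (v * M%:R + 1)) => n.
have [k [r [rM nE]]] : exists k r, (r < M)%N /\ n = (r + k * M)%N.
  exists (n %/ M)%N, (n %% M)%N; split; first exact: ltn_pmod.
  by rewrite addnC -divn_eq.
have nR : n%:R = r%:R + k%:R * M%:R :> R by rewrite nE natrD natrM.
have hW : W r <= \sum_(r < M) W r.
  by rewrite (bigD1 (Ordinal rM))//= lerDl; exact: sumr_ge0.
have zE : (r%:Z, 0) + corner k = (n%:Z, k%:Z * Num.ceil (v * M%:R)).
  by rewrite /corner nE; congr pair; rewrite /= ?add0r// PoszD.
have h1 := @time_vert_end R xpredT (0, 0) n%:Z (k%:Z * Num.ceil (v * M%:R))
  (Num.ceil (v * n%:R)) f (fun _ _ _ _ _ _ _ => isT) isT isT.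
have h2 := @time_triangle R xpredT (r%:Z, 0) (0, 0) (n%:Z, k%:Z * Num.ceil (v * M%:R)) f
  (fun _ _ _ _ _ _ _ => isT) isT isT isT.
have h3 := time_chain k (r%:Z, 0) f; rewrite zE in h3.
have h4 := hB r k.
have h5 : B r <= `|B r| by exact: ler_norm.
(* Rounding adds at most 1 to the height of each block, hence the term [k]; together with the slack
   in [block_sum_ae] this makes the 2 in the rate. *)
have hc : (`|Num.ceil (v * n%:R) - k%:Z * Num.ceil (v * M%:R)|%:~R : R) <=
    k%:R + (v * M%:R + 1).
  rewrite intr_norm intrB intrM.
  have := ceil_bounds (v * n%:R); have := ceil_bounds (v * M%:R).
  move: (Num.ceil (v * n%:R))%:~R (Num.ceil (v * M%:R))%:~R => cn cM /andP[a1 a2] /andP[a3 a4].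
  apply: (@ceil_arith R cn (v * n%:R) (v * r%:R) (v * M%:R) (k%:R * (v * M%:R)) (k%:R * cM)) => //.
  - by rewrite nR; ring.
  - by rewrite ler_wpM2l.
  - by rewrite -[X in _ <= _ + X]mulr1 -mulrDr ler_wpM2l// ltW.
  - by rewrite mulr_ge0.
  - by rewrite ler_wpM2l// ler_nat ltnW.
have hk : (strip_mean mu v M + 2) * k%:R <= (strip_mean mu v M + 2) / M%:R * n%:R.
  rewrite -mulrA ler_wpM2l ?addr_ge0// mulrC ler_pdivlMr// nR lerDr//.
exact: upper_arith h1 h2 h3 h4 h5 hc hk hW.
Qed.

End Block.

(** Apply [upper_block] with [M] so large that [strip_mean / M] is within [e / 2] of the speed and
    [2 / M] is at most [e / 2]. *)
Lemma upper_ae e : 0 < e -> {ae mu, forall f, exists B, forall n,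
  time xpredT (0, 0) (target v n) f <= (speed mu v + e) * n%:R + B}.
Proof.
move=> e0; have [s0 sc _] := speedP muG v.
have e2 : 0 < e / 2 by rewrite divr_gt0.
have /cvgrPdist_le/(_ _ e2)[M1 _ hM1] := sc.
have [M [M0 hs h2]] : exists M : nat, [/\ (0 < M)%N,
    strip_mean mu v M / M%:R <= speed mu v + e / 2 & 2 / M%:R <= e / 2].
  pose M2 := (Num.truncn (2 / (e / 2))).+1; exists (maxn M1 M2).
  have MR : 0 < (maxn M1 M2)%:R :> R by rewrite ltr0n /M2; lia.
  split; first by rewrite /M2; lia.
    have := hM1 (maxn M1 M2) (leq_maxl _ _); rewrite /= distrC ler_norml => /andP[_].
    by rewrite lerBlDl.
  rewrite ler_pdivrMr// mulrC -ler_pdivrMr//.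
  apply: le_trans (ltW (truncnS_gt _)) _.
  by rewrite ler_nat leq_maxr.
have := upper_block M0; apply: filterS => f [B hB]; exists B => n.
apply: le_trans (hB n) _; rewrite lerD2r ler_wpM2r// mulrDl.
have -> : speed mu v + e = speed mu v + e / 2 + e / 2 by field.
exact: lerD.
Qed.

End Upper.

(** * Convergence *)

Section Convergence.
Variables (R : realType) (G : probability R R) (mu : probability (env R) R).
Hypothesis muG : iid_law G mu.
Variable v : R.
Hypothesis v0 : 0 <= v.

Let Tn (n : nat) (f : env R) : R := time xpredT (0, 0) (target v n) f.

Let mTn n : measurable_fun setT (Tn n).
Proof. exact: measurable_time. Qed.

Lemma time_cvg_ae : {ae mu, forall f, (fun n => Tn n f / n%:R) @ \oo --> speed mu v}.
Proof.
set s := speed mu v.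
have c0 j : 0 < j.+1%:R^-1 :> R by rewrite invr_gt0.
(* Only the countably many margins [1 / (j + 1)] are used, so one null set covers all of them. *)
have hl : {ae mu, forall f, forall j : nat, ~ io_below (Tn ^~ f) (s - j.+1%:R^-1)}.
  apply: ae_foralln => j; apply: ae_not_io_below => //.
  by apply: (lower_tail muG v0); rewrite ltrBlDr ltrDl.
have hu : {ae mu, forall f, forall j : nat, exists B, forall n,
    Tn n f <= (s + j.+1%:R^-1) * n%:R + B}.
  by apply: ae_foralln => j; exact: (upper_ae muG v0).
apply: filterS2 hl hu => f hl hu.
apply/cvgrPdist_le => e e0.
have [j hj] : exists j : nat, j.+1%:R^-1 <= e / 2.
  exists (Num.truncn (e / 2)^-1).
  by rewrite invf_ple ?posrE ?divr_gt0// ltW// truncnS_gt.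
have [n1 hn1] := not_io_below (hl j) (c0 j).
have [B hB] := hu j.
have [n2 hn2] : exists n2 : nat, B <= e / 2 * n2%:R.
  exists (Num.truncn (B / (e / 2))).+1.
  by rewrite mulrC -ler_pdivrMr ?divr_gt0// ltW// truncnS_gt.
exists (maxn 1 (maxn n1 n2)) => // n /= hn.
have n0 : 0 < n%:R :> R by rewrite ltr0n; lia.
have h1 := hn1 n; have {}h1 : (s - j.+1%:R^-1 - j.+1%:R^-1) * n%:R <= Tn n f by apply: h1; lia.
have h2 := hB n.
have h3 : B <= e / 2 * n%:R.
  apply: le_trans hn2 _; apply: ler_wpM2l; first by rewrite divr_ge0// ltW.
  by rewrite ler_nat; lia.
rewrite distrC ler_norml; apply/andP; split.
  rewrite lerBrDr ler_pdivlMr//; apply: le_trans h1; rewrite ler_wpM2r//.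
  by move: (j.+1%:R^-1) hj => c hj; lra.
rewrite lerBlDr ler_pdivrMr//; apply: le_trans h2 _.
apply: le_trans (lerD (lexx _) h3) _; rewrite -mulrDl ler_wpM2r//.
by move: (j.+1%:R^-1) hj => c hj; lra.
Qed.

Lemma mean_time_le_strip n : (mean mu (fun f => Tn n f / n%:R)%R <= (strip_mean mu v n / n%:R)%:E)%E.
Proof.
have ms : measurable_fun setT (time (R := R) (strip 0 n%:Z) (0, 0) (target v n)).
  exact: measurable_time.
rewrite mulrC EFinM -(strip_meanE muG) -mean_scale//; last by move=> f; exact: time_ge0.
apply: mean_le.
- exact: measurable_funM.
- exact: measurable_funM.
- by move=> f; rewrite divr_ge0//; exact: time_ge0.
move=> f; rewrite mulrC ler_wpM2l ?invr_ge0//; apply: time_mono => //=.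
- exact: col_convex_strip.
- by rewrite /strip; lia.
Qed.

(** With [s] the speed, |X - s| = X - s + 2 max(s - X, 0). The mean of X is at most
    [strip_mean / n], which tends to [s], and the last term is bounded by [2 * s], so its mean tends
    to 0 by dominated convergence. *)
Lemma time_cvg_L1 :
  (fun n => mean mu (fun f => `|Tn n f / n%:R - speed mu v|)%R) @ \oo --> 0%E.
Proof.
set s := speed mu v; have [s0 sc _] := speedP muG v.
pose X n f : R := Tn n f / n%:R.
have mX n : measurable_fun setT (X n) by exact: measurable_funM.
have X0 n f : 0 <= X n f by rewrite divr_ge0//; exact: time_ge0.
pose Y n f : R := Num.max (s - X n f) 0.
have mY n : measurable_fun setT (Y n).
  by apply: measurable_maxr => //; exact: measurable_funB.
have Y0 n f : 0 <= Y n f by rewrite le_max lexx orbT.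
have mA n : measurable_fun setT (fun f => `|X n f - s|).
  by apply: measurableT_comp => //; exact: measurable_funB.
have hY : (fun n => mean mu (Y n)) @ \oo --> 0%E.
  have mEY n : measurable_fun setT (EFin \o Y n) by exact/measurable_EFinP.
  have cY : {ae mu, forall f, setT f -> (fun n => (EFin \o Y n) f) @ \oo --> (cst 0%E : env R -> \bar R) f}.
    apply: filterS time_cvg_ae => f cf _.
    apply: cvg_EFin; first exact: nearW.
    have c1 : (fun n => `|s - X n f|) @ \oo --> (0 : R).
      by rewrite -(normr0 R) -(subrr s); apply: cvg_norm; apply: cvgB => //; exact: cvg_cst.
    apply: (squeeze_cvgr _ (cvg_cst (0 : R)) c1); apply: nearW => n /=.
    by rewrite Y0 ge_max ler_norm normr_ge0.
  have dom : {ae mu, forall f n, setT f -> (`|(EFin \o Y n) f| <= (cst s%:E) f)%E}.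
    apply: aeW => f n _ /=; rewrite lee_fin ger0_norm// ge_max s0 andbT.
    by rewrite lerBlDr lerDl.
  have is_ : mu.-integrable setT (cst s%:E : env R -> \bar R).
    by apply: finite_measure_integrable_cst.
  have [_ _] := dominated_convergence measurableT mEY (measurable_cst _) cY is_ dom.
  by rewrite integral0.
have key n : (mean mu (fun f => `|X n f - s|)%R <=
    (strip_mean mu v n / n%:R - s)%:E + 2%:E * mean mu (Y n))%E.
  (* Moving [s] to the left-hand side leaves only nonnegative terms, for which [mean] is
     additive. *)
  have e1 : mean mu (fun f => `|X n f - s| + cst s f)%R = mean mu (fun f => X n f + 2 * Y n f)%R.
    congr mean; apply/funext => f; rewrite /Y /=.
    case: (ger0P (X n f - s)) => h; case: (leP (s - X n f) 0) => h'; lra.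
  have m2Y : measurable_fun setT (fun f => 2 * Y n f) by exact: measurable_funM.
  have p2Y f : 0 <= 2 * Y n f by rewrite mulr_ge0.
  rewrite (@mean_add _ _ _ mu _ _ (mA n) (measurable_cst s) (fun f => normr_ge0 _) (fun=> s0)) in e1.
  rewrite (@mean_add _ _ _ mu _ _ (mX n) m2Y (X0 n) p2Y) mean_cst mean_scale// in e1.
  have h := mean_time_le_strip n.
  rewrite EFinB addeAC leeBrDr// e1; apply: leeD => //.
apply: (@squeeze_cvge _ _ _ _ (fun=> 0%E) _ (fun n =>
    (strip_mean mu v n / n%:R - s)%:E + 2%:E * mean mu (Y n))%E).
- by apply: nearW => n; rewrite key mean_ge0.
- exact: cvg_cst.
rewrite -[X in _ --> X]adde0 -[X in _ --> (_ + X)%E](mule0 2%:E).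
apply: cvgeD => //.
  apply: cvg_EFin; first exact: nearW.
  by rewrite -(subrr s); apply: cvgB => //; exact: cvg_cst.
by apply: cvgeZl.
Qed.

End Convergence.

(** * From the environment law to an arbitrary model *)

Section Transfer.
Variables (R : realType) (G : probability R R).
Hypothesis HG : G [set x : R | 0 <= x] = 1%E.
Context d (Omega : measurableType d) (P : probability Omega R) (tau : pt -> Omega -> R).
Hypothesis mtau : forall e, measurable_fun setT (tau e).
Hypothesis tau_law : forall e A, measurable A -> P (tau e @^-1` A) = G A.
Hypothesis tau_indep : mutually_independent P tau.

Definition env_of (w : Omega) : env R := fun e => tau e w.

Lemma measurable_env_of : measurable_fun setT env_of.
Proof. by apply: measurable_env => e; exact: mtau. Qed.

Let menv := isMeasurableFun.Build _ _ _ _ _ measurable_env_of.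
Definition env_mfun : {mfun Omega >-> env R} := HB.pack env_of menv.

Definition model_law : probability (env R) R := distribution P env_mfun.

Lemma model_law_iid : iid_law G model_law.
Proof.
move=> s A us mA; rewrite /model_law /= /distribution /pushforward.
rewrite (_ : _ @^-1` _ = \bigcap_(e in [set` s]) (tau e @^-1` A e)).
  by rewrite tau_indep//; apply: eq_bigr => e _; exact: tau_law.
by apply/seteqP; split => w h e /=; exact: h.
Qed.

(** There are countably many edges, enumerated by [unpickle], and each weight is nonnegative almost
    surely by [HG]. On this event the absolute values in [time] disappear. *)
Lemma tau_ge0_ae : {ae P, forall w, forall e, 0 <= tau e w}.
Proof.
have m0 : measurable [set x : R | 0 <= x].
  rewrite (_ : [set x | _] = [set` `[(0 : R), +oo[]); first exact: measurable_itv.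
  by apply/seteqP; split => x; rewrite /= in_itv /= andbT.
have h : {ae P, forall w, forall n : nat, if unpickle n is Some e then 0 <= tau (e : pt) w else true}.
  apply: ae_foralln => n; case: unpickle => [e|]; last exact: aeW.
  exists (~` (tau e @^-1` [set x | 0 <= x])).
  have me : measurable (tau e @^-1` [set x | 0 <= x]).
    by rewrite -[X in measurable X]setTI; exact: mtau.
  split; first exact: measurableC.
    rewrite [LHS](probability_setC P me) [X in (_ - X)%E](tau_law e m0).
    by rewrite [X in (_ - X)%E]HG subee.
  by move=> w /=.
apply: filterS h => w hw e; have := hw (pickle e); by rewrite pickleK.
Qed.

Lemma passage_time_env (v : R) n w : (forall e, 0 <= tau e w) ->
  passage_time (fun e => tau e w) (0, 0) (target v n) =
  time xpredT (0, 0) (target v n) (env_of w).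
Proof.
move=> h; rewrite passage_timeE /time /env_of; congr restricted_time.
by apply/funext => e; rewrite ger0_norm.
Qed.

Lemma model_cvg v : 0 <= v ->
  let Tn := fun (n : nat) (w : Omega) =>
    passage_time (fun e => tau e w) (0%Z, 0%Z) (n%:Z, Num.ceil (v * n%:R)) / n%:R in
  {ae P, forall w, (Tn ^~ w) @ \oo --> speed model_law v} /\
  ((fun n : nat => (\int[P]_w (`|Tn n w - speed model_law v|)%:E)%E) @ \oo --> (0:R)%:E).
Proof.
move=> v0 Tn; split.
  have [N [mN N0 hN]] := time_cvg_ae model_law_iid v0.
  have hae : {ae P, forall w, (fun n => time xpredT (0, 0) (target v n) (env_of w) / n%:R) @ \oo
      --> speed model_law v}.
    exists (env_of @^-1` N); split.
    - by rewrite -[X in measurable X]setTI; exact: measurable_env_of.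
    - exact: N0.
    - by move=> w h; apply: hN.
  apply: filterS2 hae tau_ge0_ae => w cw tw; rewrite /Tn.
  rewrite (_ : (fun n => _) = fun n => time xpredT (0, 0) (target v n) (env_of w) / n%:R)//.
  by apply/funext => n; rewrite -passage_time_env.
have h := time_cvg_L1 model_law_iid v0.
rewrite (_ : (fun n => _) = fun n => mean model_law
  (fun f => `|time xpredT (0, 0) (target v n) f / n%:R - speed model_law v|))//.
apply/funext => n.
have mA : measurable_fun setT
    (fun f : env R => `|time xpredT (0, 0) (target v n) f / n%:R - speed model_law v|).
  apply: measurableT_comp => //; apply: measurable_funB => //.
  by apply: measurable_funM => //; exact: measurable_time.
have hp := @ge0_integral_pushforward _ _ _ _ R env_mfun measurable_env_of P setT
  (fun f => (`|time xpredT (0, 0) (target v n) f / n%:R - speed model_law v|)%:E) measurableT.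
rewrite preimage_setT in hp.
rewrite /mean [RHS]hp; last 2 first.
- exact/measurable_EFinP.
- by move=> f _; rewrite lee_fin.
apply: ae_eq_integral => //.
- apply/measurable_EFinP; apply: measurableT_comp => //; apply: measurable_funB => //.
  apply: measurable_funM => //.
  rewrite (_ : (fun w => _) = fun w => restricted_time xpredT (tau ^~ w) (0, 0) (target v n)).
    exact: measurable_restricted_time.
  by apply/funext => w; rewrite passage_timeE.
- by apply/measurable_EFinP; apply: (measurableT_comp mA); exact: measurable_env_of.
by apply: filterS tau_ge0_ae => w tw _; rewrite /Tn /= -passage_time_env.
Qed.

End Transfer.

(** * Existence of the limit function *)

Unset Implicit Arguments.

Theorem theorem1p1 (R : realType) (G : probability R R)
  (HG : G [set x : R | 0 <= x] = 1%E) :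
  exists Lambda : R -> R,
    (forall v, 0 <= v -> 0 <= Lambda v) /\ convex_on_nonneg Lambda /\
    forall (d : measure_display) (Omega : measurableType d)
      (P : probability Omega R) (tau : pt -> Omega -> R),
      (forall e, measurable_fun setT (tau e)) ->
      (forall e A, measurable A -> P (tau e @^-1` A) = G A) ->
      mutually_independent P tau ->
      forall v : R, 0 <= v ->
        let Tn := fun (n : nat) (w : Omega) =>
          passage_time (fun e => tau e w) (0%Z, 0%Z)
            (n%:Z, Num.ceil (v * n%:R)) / n%:R in
        {ae P, forall w, (Tn ^~ w) @ \oo --> Lambda v} /\
        ((fun n : nat => (\int[P]_w (`|Tn n w - Lambda v|)%:E)%E) @ \oo --> (0:R)%:E).
Proof.
(* The limit function has to be chosen before the model. An i.i.d. environment law is determined by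
   [G], hence so is its speed. *)
have speed_eq (mu mu' : probability (env R) R) : iid_law G mu -> iid_law G mu' ->
    speed mu = speed mu'.
  move=> h h'; apply/funext => v; rewrite /speed.
  rewrite (_ : (fun n => strip_mean mu v n / _) = fun n => strip_mean mu' v n / n%:R)//.
  apply/funext => n; congr (_ / _); congr fine.
  apply: eq_measure_integral => B mB _.
  apply: env_measure_unique => //.
    by move=> s A us mA; exact: etrans (h s A us mA) (esym (h' s A us mA)).
  exact: le_lt_trans (probability_le1 mu measurableT) (ltry _).
(* If no environment law is i.i.d. with marginal G, then no model exists. *)
have [[mu hmu]|nomu] := pselect (exists mu : probability (env R) R, iid_law G mu).
  exists (speed mu); split; [|split].
  - by move=> v _; have [] := speedP hmu v.
  - exact: speed_convex hmu.
  - move=> d Omega P tau m1 m2 m3 v v0.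
    by rewrite (speed_eq _ _ hmu (model_law_iid m1 m2 m3)); 
    exact: (@model_cvg R G HG d Omega P tau m1 m2 m3 v v0).
exists (fun=> 0); split => //; split.
  by move=> a b t _ _ _; rewrite !mulr0 addr0.
move=> d Omega P tau m1 m2 m3; exfalso; apply: nomu.
by exists (model_law P m1); exact: model_law_iid.
Qed.
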